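(* Let $m\ge 1$ be an integer, let $\gamma>0$ and $p_0\in[1,\infty)$, and let $p_0<p_1,\dots,p_m<\infty$ with $\frac1p=\frac1{p_1}+\dots+\frac1{p_m}$. Assume that either $\gamma\ge p_0$, or $\gamma<p_0$ and $p>\gamma$. Then there is a constant $C$, depending only on the dimension $n$ and on $m,\gamma,p_0,p_1,\dots,p_m$, such that the following holds. Let $\mathcal S$ be a sparse family in a dyadic grid $\mathcal D$ of $\mathbb R^n$, and let $w$ and $\vec\sigma=(\sigma_1,\dots,\sigma_m)$ be weights on $\mathbb R^n$ with $[w,\vec\sigma]_{A_{\vec P/p_0}}<\infty$ and $w,\sigma_1,\dots,\sigma_m\in A_\infty$. Put $w_i=\sigma_i^{1-\frac{p_i}{p_0}}$ for $i=1,\dots,m$. Then for all $\vec f=(f_1,\dots,f_m)$ with $f_i\in L^{p_i}(w_i)$, $$\big\|T_{p_0,\gamma,\mathcal S}(\vec f)\big\|_{L^p(w)}\le C\,[w,\vec\sigma]_{A_{\vec P/p_0}}^{\frac1p}\Big(\prod_{i=1}^m[\sigma_i]_{A_\infty}^{\frac1{p_i}}+[w]_{A_\infty}^{\left(\frac1\gamma-\frac1p\right)_+}\sum_{j=1}^m\prod_{i\ne j}[\sigma_i]_{A_\infty}^{\frac1{p_i}}\Big)\prod_{i=1}^m\|f_i\|_{L^{p_i}(w_i)},$$ where $\left(\frac1\gamma-\frac1p\right)_+=\max\left\{\frac1\gamma-\frac1p,0\right\}$.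
   Context: A weight is a locally integrable function on $\mathbb R^n$ that is positive almost everywhere. For a cube $Q$, $\langle f\rangle_Q=\frac1{|Q|}\int_Q f\,dx$ and $\langle f\rangle_{Q,p_0}=\big(\frac1{|Q|}\int_Q|f(x)|^{p_0}dx\big)^{1/p_0}$. Also $w(Q)=\int_Q w\,dx$, and $\|f\|_{L^p(w)}=\big(\int|f|^p w\,dx\big)^{1/p}$ (a quasi-norm if $p<1$). Dyadic grid: a collection $\mathcal D$ of cubes in $\mathbb R^n$ with side lengths $2^k$, $k\in\mathbb Z$, such that for each $k$ the cubes of side length $2^k$ partition $\mathbb R^n$, and any two cubes of $\mathcal D$ are either disjoint or one contains the other. Sparse family: a collection $\mathcal S\subset\mathcal D$ such that for every $Q\in\mathcal S$, $\Big|\bigcup_{Q'\in\mathcal S,\ Q'\subsetneq Q}Q'\Big|\le\frac12|Q|$. General multilinear sparse operator: $$T_{p_0,\gamma,\mathcal S}(\vec f)(x)=\Big(\sum_{Q\in\mathcal S}\Big[\prod_{i=1}^m\langle f_i\rangle_{Q,p_0}\Big]^\gamma\chi_Q(x)\Big)^{1/\gamma}.$$ Weight constants: for $\vec R=(r_1,\dots,r_m)$ with $1<r_i<\infty$ and $\frac1r=\sum_{i=1}^m\frac1{r_i}$, $$[w,\vec\sigma]_{A_{\vec R}}=\sup_Q\langle w\rangle_Q\prod_{i=1}^m\langle\sigma_i\rangle_Q^{\frac r{r_i'}},$$ where the supremum is over all cubes $Q\subset\mathbb R^n$ and $r_i'=r_i/(r_i-1)$. With $\vec P=(p_1,\dots,p_m)$,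 $\vec P/p_0=(p_1/p_0,\dots,p_m/p_0)$, so in $[w,\vec\sigma]_{A_{\vec P/p_0}}$ one has $r_i=p_i/p_0$ and $r=p/p_0$. No relation between $w$ and the $\sigma_i$ is assumed. $A_\infty$ constant: $[w]_{A_\infty}=\sup_Q\frac1{w(Q)}\int_Q M(\mathbf 1_Q w)\,dx$, where the supremum is over all cubes $Q\subset\mathbb R^n$ and $M$ is the Hardy–Littlewood maximal operator; $w\in A_\infty$ means $[w]_{A_\infty}<\infty$. An empty product equals $1$. *)

(* Defs.v *)
From HB Require Import structures.
From mathcomp Require Import all_boot all_order all_algebra.
From mathcomp Require Import all_classical all_reals all_analysis.

Set Implicit Arguments.
Unset Strict Implicit.
Unset Printing Implicit Defensive.

Import Order.TTheory GRing.Theory Num.Theory.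
Import numFieldNormedType.Exports.

Local Open Scope classical_set_scope.
Local Open Scope ring_scope.
Local Open Scope ereal_scope.

(** MathComp-Analysis has Lebesgue measure on the line and the Borel
    sigma-algebra on [n.-tuple R], but no Lebesgue measure on [R^n].  It is
    obtained here on Borel sets as the [n]-fold product of the one-dimensional
    measure, and then completed, so that measurability below is Lebesgue
    measurability. *)

Definition tuple_cons (R : realType) n (x : R * n.-tuple R) : n.+1.-tuple R :=
  [tuple of x.1 :: x.2].

Definition tuple_uncons (R : realType) n (x : n.+1.-tuple R) : R * n.-tuple R :=
  (thead x, [tuple of behead x]).

Lemma tuple_consK (R : realType) n : cancel (@tuple_cons R n) (@tuple_uncons R n).
Proof.
by move=> [a x]; rewrite /tuple_uncons theadE; congr (_, _); exact/val_inj.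
Qed.

Lemma measurable_tuple_cons (R : realType) n :
  measurable_fun [set: R * n.-tuple R] (@tuple_cons R n).
Proof. exact: measurable_cons. Qed.

Lemma measurable_tuple_uncons (R : realType) n :
  measurable_fun [set: n.+1.-tuple R] (@tuple_uncons R n).
Proof.
apply/measurable_fun_pairP; split; first exact: measurable_tnth.
exact: measurable_behead.
Qed.

Section borel_cons.
Context {R : realType} (n : nat).
Variable mu : {sigma_finite_measure set (n.-tuple R) -> \bar R}.

Definition borel_cons : set (n.+1.-tuple R) -> \bar R :=
  pushforward (@lebesgue_measure R \x mu) (@tuple_cons R n).

Let borel_cons0 : borel_cons set0 = 0.
Proof. by rewrite /borel_cons /pushforward preimage_set0 measure0. Qed.

Let borel_cons_ge0 A : 0 <= borel_cons A.
Proof. by rewrite /borel_cons /pushforward measure_ge0. Qed.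

Let borel_cons_sigma_additive : semi_sigma_additive borel_cons.
Proof.
pose m := measure_function_pushforward__canonical__measure_function_Measure
  (@lebesgue_measure R \x mu) (@measurable_tuple_cons R n).
exact (@measure_semi_sigma_additive _ _ _ m).
Qed.

HB.instance Definition _ := isMeasure.Build _ _ _ borel_cons
  borel_cons0 borel_cons_ge0 borel_cons_sigma_additive.

Let borel_cons_sigma_finite : sigma_finite setT borel_cons.
Proof.
have /sigma_finiteP[F [TF ndF mF]] := sigma_finiteT (@lebesgue_measure R).
have /sigma_finiteP[G [TG ndG mG]] := sigma_finiteT mu.
exists (fun k => @tuple_uncons R n @^-1` (F k `*` G k)).
  apply/esym/seteqP; split => // x _.
  have [i _ Fi] : (\bigcup_i F i) (tuple_uncons x).1 by rewrite -TF.
  have [j _ Gj] : (\bigcup_i G i) (tuple_uncons x).2 by rewrite -TG.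
  exists (maxn i j) => //; split.
    by move: Fi; exact/subsetPset/ndF/leq_maxl.
  by move: Gj; exact/subsetPset/ndG/leq_maxr.
move=> k; have [mFk Fk] := mF k; have [mGk Gk] := mG k; split.
  rewrite -[X in measurable X]setTI; apply: measurable_tuple_uncons => //.
  exact: measurableX.
rewrite /borel_cons /pushforward -comp_preimage.
rewrite (_ : _ \o _ = id) ?preimage_id; last first.
  by apply/funext => x /=; rewrite tuple_consK.
by rewrite product_measure1E// lte_mul_pinfty// ge0_fin_numE.
Qed.

HB.instance Definition _ := Measure_isSigmaFinite.Build _ _ _ borel_cons
  borel_cons_sigma_finite.

End borel_cons.

Fixpoint borel_lebesgue (R : realType) (n : nat) :
    {sigma_finite_measure set (n.-tuple R) -> \bar R} :=
  match n with
  | 0%N => [the {sigma_finite_measure set (0.-tuple R) -> \bar R}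
              of @dirac _ (0.-tuple R) [tuple] R]
  | k.+1 => [the {sigma_finite_measure set (k.+1.-tuple R) -> \bar R}
              of borel_cons (borel_lebesgue R k)]
  end.

Definition Rn (R : realType) (n : nat) :=
  caratheodory_type (borel_lebesgue R n)^*%mu.
HB.instance Definition _ (R : realType) (n : nat) := Measurable.on (Rn R n).

Definition lebesgue_Rn (R : realType) (n : nat) : set (Rn R n) -> \bar R :=
  @completed_measure_extension _ _ R (borel_lebesgue R n).
HB.instance Definition _ (R : realType) (n : nat) :=
  Measure.on (@lebesgue_Rn R n).

Lemma measurable_box (R : realType) n (A : 'I_n -> set R) :
  (forall i, measurable (A i)) ->
  measurable [set x : n.-tuple R | forall i, A i (tnth x i)].
Proof.
move=> mA; have -> : [set x : n.-tuple R | forall i, A i (tnth x i)] =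
    \bigcap_(i in [set: 'I_n]) ((fun x : n.-tuple R => tnth x i) @^-1` A i).
  by apply/seteqP; split => x /= H i; [move=> _|]; exact: H.
apply: fin_bigcap_measurable => // i _; rewrite -[X in measurable X]setTI.
exact: measurable_tnth.
Qed.

Lemma borel_lebesgue_box (R : realType) n (A : 'I_n -> set R) :
  (forall i, measurable (A i)) ->
  borel_lebesgue R n [set x | forall i, A i (tnth x i)] =
  \prod_(i < n) lebesgue_measure (A i).
Proof.
elim: n A => [|n IHn] A mA.
  rewrite big_ord0 /= diracE mem_set// => -[].
by [].
rewrite big_ord_recl /= /borel_cons /pushforward.
rewrite (_ : _ @^-1` _ =
    A ord0 `*` [set x | forall i, A (lift ord0 i) (tnth x i)]).
  rewrite product_measure1E//; first by congr (_ * _); exact: IHn.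
    exact: mA.
  exact: (measurable_box (fun i => mA (lift ord0 i))).
apply/seteqP; split => -[a x] /=.
  move=> H; split; first exact: (H ord0).
  by move=> i; have := H (lift ord0 i); rewrite tnthS.
move=> [Aa Ax] i; case: (unliftP ord0 i) => [j|] ->//.
by rewrite tnthS; exact: Ax.
Qed.

Lemma lebesgue_Rn_box (R : realType) n (A : 'I_n -> set R) :
  (forall i, measurable (A i)) ->
  lebesgue_Rn ([set x | forall i, A i (tnth x i)] : set (Rn R n)) =
  \prod_(i < n) lebesgue_measure (A i).
Proof.
move=> mA; rewrite -borel_lebesgue_box//.
rewrite /lebesgue_Rn /completed_measure_extension measurable_mu_extE//.
exact: measurable_box.
Qed.

Section weights.
Context {R : realType} {n : nat}.
Local Notation mu := (@lebesgue_Rn R n).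
Implicit Types (Q : set (Rn R n)) (w : Rn R n -> R).

(** Axis-parallel cubes of side length [l].  The Booleans [b i] and [c i] tell
    which faces belong to the cube, so that open, closed and half-open cubes
    are all covered. *)
Definition cube_of_side (l : R) Q :=
  (0 < l)%R /\ exists (a : n.-tuple R) (b c : 'I_n -> bool),
    Q = [set x | forall i, tnth x i \in
           Interval (BSide (b i) (tnth a i)) (BSide (c i) (tnth a i + l)%R)].

Definition cube Q := exists l : R, cube_of_side l Q.

Definition average (f : Rn R n -> \bar R) Q : \bar R :=
  (mu Q)^-1 * \int[mu]_(x in Q) f x.

Definition Lp_average (p0 : R) (f : Rn R n -> R) Q : \bar R :=
  (average (fun x => (`|f x| `^ p0)%R%:E) Q) `^ p0^-1.

(** [Rn R n] carries no topology in the library: compactness is taken in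
    ['rV[R]_n]. *)
Definition row_of_Rn (x : Rn R n) : 'rV[R]_n := (\row_i tnth x i)%R.

Definition compact_Rn (K : set (Rn R n)) := compact (row_of_Rn @` K).

Definition locally_integrable_Rn (f : Rn R n -> R) :=
  measurable_fun setT f /\
  forall K, compact_Rn K -> \int[mu]_(x in K) `|f x|%:E < +oo.

Definition weight w :=
  locally_integrable_Rn w /\ {ae mu, forall x, (0 < w x)%R}.

Definition weighted_norm (p : R) w (f : Rn R n -> \bar R) : \bar R :=
  (\int[mu]_x (`|f x| `^ p * (w x)%:E)) `^ p^-1.

Definition weighted_Lp (p : R) w (f : Rn R n -> R) :=
  measurable_fun setT f /\ weighted_norm p w (EFin \o f) < +oo.

Definition maximal (f : Rn R n -> \bar R) (x : Rn R n) : \bar R :=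
  ereal_sup [set average (abse \o f) Q | Q in [set Q | cube Q /\ Q x]].

Definition Ainfty_constant w : \bar R :=
  ereal_sup [set (\int[mu]_(x in Q) (w x)%:E)^-1 *
                 \int[mu]_(x in Q) maximal ((EFin \o w) \_ Q) x | Q in cube].

(** With [1/r = sum_i 1/r_i], the exponent of the average of [sigma_i] is
    [r / r_i'] for [r_i' = r_i / (r_i - 1)]. *)
Definition AR_constant m (rs : 'I_m -> R) w (sigma : 'I_m -> Rn R n -> R) :
    \bar R :=
  let r := ((\sum_(i < m) (rs i)^-1)^-1)%R in
  ereal_sup [set average (EFin \o w) Q *
                 \prod_(i < m)
                   average (EFin \o sigma i) Q `^ (r / (rs i / (rs i - 1)))
            | Q in cube].

End weights.

Section sparse.
Context {R : realType} {n : nat}.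
Implicit Types (D S : set (set (Rn R n))).

Definition dyadic_grid D :=
  [/\ forall Q, D Q -> exists k : int, cube_of_side ((2 : R) ^ k)%R Q,
      forall k : int,
        let Dk := [set Q | D Q /\ cube_of_side ((2 : R) ^ k)%R Q] in
        \bigcup_(Q in Dk) Q = setT /\ trivIset Dk id &
      forall Q Q', D Q -> D Q' ->
        [\/ Q `&` Q' = set0, Q `<=` Q' | Q' `<=` Q]].

Definition sparse_family D S :=
  S `<=` D /\
  forall Q, S Q ->
    lebesgue_Rn (\bigcup_(Q' in [set Q' | S Q' /\ Q' `<` Q]) Q') <=
    (2^-1)%:E * lebesgue_Rn Q.

Definition sparse_operator m (p0 gamma : R) S (f : 'I_m -> Rn R n -> R)
    (x : Rn R n) : \bar R :=
  (\esum_(Q in S)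
     ((\prod_(i < m) Lp_average p0 (f i) Q) `^ gamma * (\1_Q x)%:E))
  `^ gamma^-1.

End sparse.

(* Main.v *)
Require Import Defs.
From mathcomp Require Import all_boot all_order all_algebra.
From mathcomp Require Import all_classical all_reals all_analysis.
From mathcomp Require Import measurable_realfun.
From mathcomp Require Import zify ring lra.

Set Implicit Arguments.
Unset Strict Implicit.
Unset Printing Implicit Defensive.

Import Order.TTheory GRing.Theory Num.Theory.
Import numFieldNormedType.Exports.

Local Open Scope classical_set_scope.
Local Open Scope ring_scope.

(** Put [g_i = |f_i|^p0] and [q_i = P_i/p0], and restrict to a finite subfamily
    of [S]; the general case follows by monotone convergence.

    If [p <= gamma], the [l^gamma]-sum is at most the [l^p]-sum.  Pulling the
    [A_R] constant out of each summand leaves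
    [sum_Q prod_i ((g_i(Q)/sigma_i(Q))^q_i sigma_i(Q))^(p/P_i)], and Hoelder's
    inequality reduces it to the Carleson embedding theorem for each [sigma_i];
    the Carleson constant is at most [2 [sigma_i]_{A_oo}] by sparseness.

    If [gamma < p], let [Phi] be the [gamma]-th power of the operator,
    [s = p/gamma] and [u = Phi^(s-1)].  Then [X = int Phi^s w] is a sum over [Q]
    in which [(u w, w)] plays the same role as the pairs [(g_i, sigma_i)].
    Split the family into slices on which the local [A_R] quantity is nearly
    constant.  Every pair [(g, sigma)] attaches to each cube the integer part
    [k] of the logarithm of the largest average of [g/sigma] over its ancestors.
    Group the cubes by their maximal ancestor [F] with the same vector of
    levels.  Inside a group the levels are frozen, and the remaining testing sum
    is bounded by a power-type Kolmogorov inequality without any [A_oo]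
    constant.  At each [F] at least one level [k_j] has just jumped; the sum
    over such [F] of [e^(k_j q_j) sigma_j(F)] is bounded by the norm of [g_j]
    alone, while the other factors cost one Carleson constant each.  Hence one
    [A_oo] factor is missing from every term.  The factor [X^(1-1/s)] coming
    from [u] is finally divided out. *)

(** * Finite sums *)

Section finite_sums.
Context {R : realType}.


(** As the exponents are distinct, each power of [x] occurs at most once, so the sum is dominated by
    the full geometric series. *)
Lemma sum_expr_inj (I : finType) (P : pred I) (d : I -> nat) (x : R) :
  0 <= x < 1 -> {in P &, injective d} ->
  \sum_(i | P i) x ^+ d i <= (1 - x)^-1.
Proof.
move=> /andP[x0 x1] dI; pose N := \max_i d i.
have dN i : (d i < N.+1)%N by rewrite ltnS; exact: leq_bigmax.
rewrite (partition_big (fun i => Ordinal (dN i)) predT)//=.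
apply: (@le_trans _ _ (\sum_(n < N.+1) x ^+ n)).
  apply: ler_sum => n _.
  have [i /andP[Pi /eqP din]|none] :=
      pickP (fun i => P i && (Ordinal (dN i) == n)); last first.
    by rewrite big_pred0// exprn_ge0.
  rewrite (bigD1 i)/= ?Pi ?din ?eqxx// big1 ?addr0; first by rewrite -din.
  move=> j /andP[/andP[Pj /eqP djn] /negP[]]; apply/eqP.
  by apply: dI => //; move: (congr1 val djn) (congr1 val din) => /= -> ->.
rewrite -[leRHS]mul1r ler_pdivlMr ?subr_gt0//.
have := subrX1 x N.+1; rewrite mulrC => /(congr1 -%R).
rewrite -mulrN !opprB => <-.
by rewrite gerBl exprn_ge0.
Qed.

(** Measured downwards from the ceiling [K], the integers become distinct naturals, and a geometric
    series of ratio [expR (- c)] remains. *)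
Lemma sum_expR_inj (I : finType) (P : pred I) (k : I -> int) (c : R) (K : int) :
  0 < c -> {in P &, injective k} -> (forall i, P i -> k i <= K) ->
  \sum_(i | P i) expR (c * (k i)%:~R) <= (1 - expR (- c))^-1 * expR (c * K%:~R).
Proof.
move=> c0 kI kK; pose d i := `|K - k i|%N.
have kd i : P i -> expR (c * (k i)%:~R) = expR (- c) ^+ d i * expR (c * K%:~R).
  move=> Pi; rewrite -expRM_natr -expRD.
  have -> : (d i)%:R = (K - k i)%:~R :> R.
    by rewrite -[in RHS](gez0_abs (m := K - k i)) ?subr_ge0 ?kK.
  by congr expR; rewrite rmorphB /=; ring.
rewrite (eq_bigr _ kd) -big_distrl/= ler_pM2r ?expR_gt0//.
apply: sum_expr_inj; first by rewrite expR_ge0 expR_lt1 oppr_lt0.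
move=> i j Pi Pj; have := kK _ Pi; have := kK _ Pj; rewrite /d => ? ? ?.
apply: kI => //; lia.
Qed.

Lemma prod_powR_sum (L : finType) (th : L -> R) (x : R) :
  0 <= x -> (forall l, 0 < th l) -> (0 < #|L|)%N -> \prod_l x `^ th l = x `^ (\sum_l th l).
Proof.
move=> x0 th0 L0; have [->|xn0] := eqVneq x 0.
  have /card_gt0P[l0 _] := L0.
  have s0 : \sum_l th l != 0.
    rewrite gt_eqF// (bigD1 l0)//= ltr_wpDr// sumr_ge0// => l _; exact: ltW.
  rewrite powR0// (bigD1 l0)//= powR0 ?mul0r// gt_eqF//.
elim/big_ind2 : _ => [|? ? ? ? -> ->|//]; first by rewrite powRr0.
by rewrite powRD// xn0 implybT.
Qed.

(** Weighted AM-GM inequality. If no [x l] vanishes, normalise by the weighted mean [A]: then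
    [ln y <= y - 1] at [y = x l / A], averaged with the weights [th], has right-hand side zero. *)
Lemma prod_powR_le_sum (L : finType) (th x : L -> R) :
  (forall l, 0 < th l) -> \sum_l th l = 1 -> (forall l, 0 <= x l) ->
  \prod_l x l `^ th l <= \sum_l th l * x l.
Proof.
move=> th0 th1 x0; set A := \sum_l _.
have A0 : 0 <= A by apply: sumr_ge0 => l _; rewrite mulr_ge0// ltW.
have [l0 xl0|xn0] := pickP (fun l => x l == 0).
  by rewrite (bigD1 l0)//= (eqP xl0) powR0 ?mul0r// gt_eqF.
have xp l : 0 < x l by rewrite lt_def x0 xn0.
have {A0} A0 : 0 < A.
  rewrite lt_def A0 andbT; apply/negP => /eqP/psumr_eq0P AE.
  have : \sum_l th l = 0.
    apply: big1 => l _; have /eqP := AE (fun l _ => mulr_ge0 (ltW (th0 l)) (x0 l)) l isT.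
    by rewrite mulf_eq0 (gt_eqF (xp l)) orbF => /eqP.
  by move/eqP; rewrite th1 oner_eq0.
have -> : \prod_l x l `^ th l = expR (\sum_l th l * ln (x l)).
  by rewrite expR_sum; apply: eq_bigr => l _; rewrite /powR (gt_eqF (xp l)).
rewrite -[leRHS]lnK ?posrE// ler_expR -subr_le0.
have -> : \sum_l th l * ln (x l) - ln A = \sum_l th l * ln (x l / A).
  rewrite -[ln A]mul1r -th1 big_distrl -sumrB; apply: eq_bigr => l _ /=.
  by rewrite ln_div ?posrE// mulrBr.
apply: (@le_trans _ _ (\sum_l th l * (x l / A - 1))).
  apply: ler_sum => l _; rewrite ler_pM2l//.
  have := @le_ln1Dx R (x l / A - 1); rewrite [1 + _]addrC subrK; apply.
  by rewrite ltrBrDl subrr divr_gt0.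
rewrite le_eqVlt; apply/orP; left; apply/eqP.
under eq_bigr do rewrite mulrBr mulr1 mulrA.
by rewrite sumrB th1 -big_distrl/= -/A divff ?subrr// gt_eqF.
Qed.

(** Hoelder's inequality with exponents [1 / th l]: after dividing each [x l] by its total, AM-GM
    applies termwise and the bounds sum to one. *)
Lemma sum_prod_powR_le (L I : finType) (P : pred I) (th : L -> R) (x : L -> I -> R) :
  (forall l, 0 < th l) -> \sum_l th l = 1 -> (forall l i, 0 <= x l i) ->
  \sum_(i | P i) \prod_l x l i `^ th l <= \prod_l (\sum_(i | P i) x l i) `^ th l.
Proof.
move=> th0 th1 x0; set X := fun l => \sum_(i | P i) x l i.
have X0 l : 0 <= X l by exact: sumr_ge0.
have [l0 Xl0|Xn0] := pickP (fun l => X l == 0).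
  rewrite big1 ?prodr_ge0// => [l _|i Pi]; first exact: powR_ge0.
  rewrite (bigD1 l0)//= (_ : x l0 i = 0) ?powR0 ?mul0r// ?gt_eqF//.
  by move/eqP/psumr_eq0P : Xl0; apply.
have Xp l : 0 < X l by rewrite lt_def X0 Xn0.
have E i : \prod_l x l i `^ th l =
    (\prod_l (x l i / X l) `^ th l) * \prod_l X l `^ th l.
  rewrite -big_split; apply: eq_bigr => l _ /=.
  by rewrite -powRM ?divfK ?divr_ge0// gt_eqF.
rewrite (eq_bigr _ (fun i _ => E i)) -big_distrl/=.
rewrite -[leRHS]mul1r ler_wpM2r ?prodr_ge0// => [l _|]; first exact: powR_ge0.
apply: (@le_trans _ _ (\sum_(i | P i) \sum_l th l * (x l i / X l))).
  by apply: ler_sum => i _; apply: prod_powR_le_sum => // l; rewrite divr_ge0.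
rewrite exchange_big/= -th1 le_eqVlt; apply/orP; left; apply/eqP.
apply: eq_bigr => l _; rewrite -big_distrr/= -big_distrl/= divff ?mulr1 ?gt_eqF//.
exact: Xp.
Qed.

(** The shares [c i / C] sum to one and lie in the unit interval, where a power with exponent
    [r <= 1] does not decrease a number. *)
Lemma powR_sum_le (I : finType) (P : pred I) (c : I -> R) (r : R) :
  0 < r <= 1 -> (forall i, 0 <= c i) ->
  (\sum_(i | P i) c i) `^ r <= \sum_(i | P i) c i `^ r.
Proof.
move=> /andP[r0 r1] c0; set C := \sum_(i | P i) c i.
have C0 : 0 <= C by exact: sumr_ge0.
have [CE|Cn0] := eqVneq C 0.
  by rewrite CE powR0 ?gt_eqF// sumr_ge0// => i _; exact: powR_ge0.
have Cp : 0 < C by rewrite lt_def Cn0.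
have cC i : P i -> c i <= C by move=> Pi; rewrite /C (bigD1 i)//= lerDl sumr_ge0.
have -> : C `^ r = \sum_(i | P i) C `^ r * (c i / C).
  by rewrite -big_distrr/= -big_distrl/= divff ?mulr1.
apply: ler_sum => i Pi.
have -> : c i `^ r = C `^ r * (c i / C) `^ r.
  by rewrite -powRM ?divr_ge0// mulrCA divff ?mulr1.
rewrite ler_wpM2l ?powR_ge0//.
have [->|cn0] := eqVneq (c i / C) 0; first by rewrite powR0// gt_eqF.
rewrite -[leLHS]powRr1 ?divr_ge0//.
apply: ger_powR => //.
by rewrite lt_def cn0 divr_ge0//= ler_pdivrMr ?mul1r ?cC.
Qed.

End finite_sums.

(** * Levels and stopping elements in a finite forest *)

Section stopping.
Context {R : realType} (I : finType) (le : rel I).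
Hypothesis le_refl : reflexive le.
Hypothesis le_trans' : transitive le.
Hypothesis le_anti : antisymmetric le.
Hypothesis le_chain : forall i j j', le i j -> le i j' -> le j j' || le j' j.

(** The relation [le] models inclusion of sets. A level behaves like a maximum over all ancestors:
    it can only rise on the way down. *)
Definition antitone (k : I -> int) := forall i j, le i j -> k j <= k i.

(** For an antitone level these are the elements where the level has just jumped: every strict
    ancestor has a smaller value. *)
Definition stop (k : I -> int) i := [forall j, le i j && (k j == k i) ==> (j == i)].

Lemma stopP k i : reflect (forall j, le i j -> k j = k i -> j = i) (stop k i).
Proof.
apply: (iffP forallP) => H j.
  by move=> ij /eqP kji; apply/eqP; have := H j; rewrite ij kji.
by apply/implyP => /andP[ij /eqP kji]; apply/eqP; exact: H.
Qed.

(** The number of elements below serves as a strictly increasing rank, so that extremal ancestors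
    can be picked by counting. *)
Lemma card_below i j : le i j -> i != j -> (#|[pred l | le l i]| < #|[pred l | le l j]|)%N.
Proof.
move=> ij neq; apply: proper_card; apply/fintype.properP; split.
  by apply/fintype.subsetP => l; rewrite !inE => /le_trans'; apply.
exists j; rewrite !inE ?le_refl//; apply/negP => ji.
by move/negP: neq; apply; apply/eqP; apply: le_anti; rewrite ij ji.
Qed.

(** Among the ancestors of equal level, one of maximal rank has no strict ancestor of that level. *)
Lemma stop_above k i : exists j, [/\ le i j, k j = k i & stop k j].
Proof.
have i0 : le i i && (k i == k i) by rewrite le_refl eqxx.
case: (@arg_maxnP _ i (fun j => le i j && (k j == k i))
  (fun j => #|[pred l | le l j]|) i0) => j /andP[ij /eqP kji] jmax.
exists j; split => //; apply/stopP => j' jj' kj'.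
apply/eqP/negPn/negP => neq.
have := jmax j'; rewrite (le_trans' ij jj') kj' kji eqxx => /(_ isT).
by rewrite /= leqNgt card_below// eq_sym.
Qed.

(** The differences [k l i - k l j] are nonnegative, so a vanishing total kills each of them. Hence
    a single integer, the sum, records equality of the whole vector of levels along a chain. *)
Lemma antitone_sum_eq (L : finType) (k : L -> I -> int) i j :
  (forall l, antitone (k l)) -> le i j ->
  \sum_l k l j = \sum_l k l i -> forall l, k l j = k l i.
Proof.
move=> ak ij /esym/eqP; rewrite -subr_eq0 -sumrB => /eqP/psumr_eq0P H l.
apply/esym/eqP; rewrite -subr_eq0; apply/eqP; apply: H => // l' _.
by rewrite subr_ge0; exact: ak.
Qed.

(** A root stops for every [l]. Otherwise pass to the parent of [i]: the sum changes there, so some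
    [k l] does; all strict ancestors lie above the parent, and antitony keeps that [k l] from
    returning to its value at [i]. *)
Lemma stop_sum (L : finType) (k : L -> I -> int) i :
  (0 < #|L|)%N -> (forall l, antitone (k l)) ->
  stop (fun i => \sum_l k l i) i -> exists l, stop (k l) i.
Proof.
move=> /card_gt0P[l0 _] ak /stopP si.
have [j0 /andP[ij0 nij0]|none] := pickP (fun j => le i j && (j != i)); last first.
  exists l0; apply/stopP => j ij _; apply/eqP.
  by have /negbT := none j; rewrite ij/= negbK.
have P0 : le i j0 && (j0 != i) by rewrite ij0.
(* Fewest elements below singles out the parent, because the ancestors form a chain. *)
case: (@arg_minnP _ j0 (fun j => le i j && (j != i))
  (fun j => #|[pred l | le l j]|) P0) => j /andP[ij nij] jmin.
have [l Hl] : exists l, k l j != k l i.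
  apply: contrapT => H; move/negP: nij; apply; apply/eqP; apply: si => //.
  by apply: eq_bigr => l _; apply: contrapT => /eqP ?; apply: H; exists l.
exists l; apply/stopP => j' ij' kj'; apply/eqP/negPn/negP => nij'.
have jj' : le j j'.
  have [/eqP<-//|neq] := boolP (j == j').
  have /orP[//|j'j] := le_chain ij ij'.
  have := jmin j'; rewrite ij' nij' => /(_ isT).
  by rewrite /= leqNgt card_below// eq_sym.
have := ak l _ _ jj'; have := ak l _ _ ij; rewrite kj' => h1 h2.
by move/negP: Hl; apply; rewrite eq_le h1 h2.
Qed.

(** Take [k i] to be the maximum of [floor (ln a)] over the ancestors of [i]. At a stopping element
    it is attained at the element itself, whence the lower bound; the upper bound loses one unit to
    rounding. *)
Lemma level_exists (a : I -> R) : (forall i, 0 < a i) ->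
  exists k, [/\ antitone k,
    forall i j, le i j -> a j < expR ((k i)%:~R + 1),
    forall i, stop k i -> expR (k i)%:~R <= a i &
    forall i j, le i j -> 1 <= a j -> 0 <= k i].
Proof.
move=> a0; pose f i := Num.floor (ln (a i)).
pose k i := f [arg max_(j > i | le i j) f j]%O.
have kP i : (forall j, le i j -> f j <= k i) /\ exists2 j, le i j & k i = f j.
  rewrite /k; case: arg_maxP => // j ij H; split; first exact: H.
  by exists j.
have ak : antitone k.
  move=> i j ij; have [_ [l jl ->]] := kP j.
  by apply: (kP i).1; exact: le_trans' jl.
exists k; split => //.
- move=> i j ij; rewrite -[ltLHS]lnK ?posrE// ltr_expR.
  apply: lt_le_trans (floorD1_gt _) _.
  by rewrite intrD lerD2r ler_int; exact: (kP i).1.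
- move=> i /stopP si; have [_ [j ij kij]] := kP i.
  have ji : j = i.
    apply: si => //; apply/eqP; rewrite eq_le ak//= kij; exact: (kP j).1.
  by rewrite kij ji -[leRHS]lnK ?posrE// ler_expR floor_le.
- move=> i j ij aj1; apply: le_trans ((kP i).1 j ij).
  by rewrite /f floor_ge0 ln_ge0.
Qed.

End stopping.

(** * Laminar families and the stopping energy *)

Section laminar.
Context {T : Type}.

(** Nonemptiness makes two members containing a common member intersect, which turns the ancestors
    into a chain. *)
Definition laminar (I : finType) (Q : I -> set T) :=
  [/\ injective Q, forall i, Q i !=set0 &
      forall i j, [\/ Q i `&` Q j = set0, Q i `<=` Q j | Q j `<=` Q i]].

Definition sub (I : finType) (Q : I -> set T) : rel I := fun i j => `[< Q i `<=` Q j >].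

Lemma laminar_comp (I J : finType) (Q : I -> set T) (h : J -> I) :
  injective h -> laminar Q -> laminar (Q \o h).
Proof. by move=> hI [QI Q0 QL]; split => //= i j /QI/hI. Qed.

Context (I : finType) (Q : I -> set T).
Hypothesis LQ : laminar Q.

Lemma sub_refl : reflexive (sub Q). Proof. by move=> i; apply/asboolP. Qed.

Lemma sub_trans : transitive (sub Q).
Proof. by move=> j i l /asboolP ij /asboolP jl; apply/asboolP; apply: subset_trans jl. Qed.

Lemma sub_anti : antisymmetric (sub Q).
Proof.
have [QI _ _] := LQ; move=> i j /andP[/asboolP ij /asboolP ji]; apply: QI.
exact/seteqP.
Qed.

Lemma sub_meet i j x : Q i x -> Q j x -> sub Q i j || sub Q j i.
Proof.
have [_ _ L] := LQ; move=> ix jx; have [E|ij|ij] := L i j.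
- by have : (Q i `&` Q j) x by []; rewrite E.
- by apply/orP; left; apply/asboolP.
- by apply/orP; right; apply/asboolP.
Qed.

Lemma sub_chain i j l : sub Q i j -> sub Q i l -> sub Q j l || sub Q l j.
Proof.
have [_ Q0 _] := LQ; move=> /asboolP ij /asboolP il; have [x ix] := Q0 i.
by apply: (@sub_meet _ _ x); [exact: ij|exact: il].
Qed.

(** Two members through the point [x] are nested, and a stopping set has no proper ancestor of its
    own level. *)
Lemma stop_level_inj k x : antitone (sub Q) k ->
  {in [pred i | stop (sub Q) k i && (x \in Q i)] &, injective k}.
Proof.
move=> ak i j; rewrite !inE => /andP[/stopP si /asboolP xi] /andP[/stopP sj /asboolP xj] kij.
by have /orP[ij|ji] := sub_meet xi xj; [exact/esym/si|exact/sj].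
Qed.

End laminar.

(** * Energy estimates over stopping sets *)

Section stopping_energy.
Context d (T : measurableType d) {R : realType} (mu : {measure set T -> \bar R}).

Lemma integral_step (I : finType) (P : pred I) (Q : I -> set T) (c : I -> R) (g : T -> R) :
  (forall i, measurable (Q i)) -> (forall i, 0 <= c i) ->
  measurable_fun setT g -> (forall x, 0 <= g x) ->
  (\int[mu]_x ((\sum_(i | P i && (x \in Q i)) c i) * g x)%:E =
   \sum_(i | P i) (c i)%:E * \int[mu]_(x in Q i) (g x)%:E)%E.
Proof.
move=> mQ c0 mg g0.
transitivity (\int[mu]_x (\sum_(i | P i) (c i)%:E * ((EFin \o g) \_ (Q i) x)))%E.
  apply: eq_integral => x _.
  rewrite big_mkcondr/= big_distrl/= -sumEFin; apply: eq_bigr => i _.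
  by rewrite patchE/=; case: ifPn => _; rewrite ?mul0r ?mule0 ?EFinM.
have g0' i x : (0 <= ((EFin \o g) \_ (Q i)) x)%E.
  by rewrite patchE; case: ifP => // _; rewrite lee_fin.
have mgi i : measurable_fun setT ((EFin \o g) \_ (Q i)).
  by apply/(measurable_restrictT _ (mQ i)).1/measurable_funTS/measurable_EFinP.
rewrite -big_filter; under eq_integral do rewrite -big_filter.
rewrite ge0_integral_sum//=.
- rewrite !big_filter; apply: eq_bigr => i _.
  by rewrite ge0_integralZl_EFin// -integral_mkcond.
- by move=> i; exact: measurable_funeM.
- by move=> i x _; rewrite mule_ge0 ?lee_fin.
Qed.

Lemma measurable_step (I : finType) (P : pred I) (Q : I -> set T) (c : I -> R) :
  (forall i, measurable (Q i)) ->
  measurable_fun setT (fun x => \sum_(i | P i && (x \in Q i)) c i).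
Proof.
move=> mQ; rewrite (_ : (fun x => _) = (fun x => \sum_(i <- enum P) c i * \1_(Q i) x)).
  by apply: measurable_sum => i; apply: measurable_funM => //; exact: measurable_indic.
apply/funext => x; rewrite big_mkcondr/= [RHS]big_enum/=; apply: eq_bigr => i _.
by rewrite indicE; case: (x \in Q i); rewrite ?mulr1 ?mulr0.
Qed.

(* [2 / (1 - e^(1-q))] is twice the sum of the geometric series of ratio [e^(1-q)]. *)
Definition energy_const (q : R) := (2 / (1 - expR (- (q - 1)))) `^ q.

(** The threshold is [y = 2 c g / s], so that [c g = y s / 2]. If [y <= E] the first term suffices;
    if [E < y], replacing [E] by [y] in [E ^ (q - 1)] produces exactly the second term. *)
Lemma energy_pointwise (q c E s g : R) :
  1 < q -> 0 < c -> 0 < E -> 0 < s -> 0 <= g ->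
  c * E `^ (q - 1) * g <= 2^-1 * (E `^ q * s) + 2^-1 * ((2 * c) `^ q * (g `^ q * s `^ (1 - q))).
Proof.
move=> q1 c0 E0 s0 g0; pose y := 2 * c * g / s.
have y0 : 0 <= y by rewrite divr_ge0 ?mulr_ge0// ltW.
have cg : c * g = 2^-1 * (y * s) by rewrite /y divfK ?gt_eqF//; field.
have splitq z : 0 < z -> z `^ q = z `^ (q - 1) * z.
  by move=> z0; rewrite -[X in _ * X]powRr1 ?ltW// -powRD ?subrK// (gt_eqF z0) implybT.
have [yE|Ey] := leP y E.
  apply: ler_wpDr.
    by rewrite !mulr_ge0 ?powR_ge0.
  rewrite mulrAC cg splitq//.
  have -> : 2^-1 * (E `^ (q - 1) * E * s) = 2^-1 * (E * s) * E `^ (q - 1) by ring.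
  by rewrite ler_wpM2r ?powR_ge0// ler_wpM2l// ler_wpM2r// ltW.
have yp : 0 < y by exact: lt_trans Ey.
apply: ler_wpDl; first by rewrite !mulr_ge0 ?powR_ge0// ltW.
rewrite mulrAC cg.
have -> : (2 * c) `^ q * (g `^ q * s `^ (1 - q)) = y `^ q * s.
  have ys : (2 * c) * g = y * s by rewrite /y divfK// gt_eqF.
  have c2 : 0 <= 2 * c by rewrite mulr_ge0 ?(ltW c0).
  rewrite mulrA -powRM// ys powRM ?(ltW s0)// -mulrA -powRD; last first.
    by rewrite (gt_eqF s0) implybT.
  by rewrite addrC subrK powRr1// ltW.
have -> : 2^-1 * (y `^ q * s) = 2^-1 * (y * s) * y `^ (q - 1).
  by rewrite (splitq y)//; ring.
apply: ler_wpM2l.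
  by apply: mulr_ge0; [rewrite invr_ge0|exact: mulr_ge0 y0 (ltW s0)].
by rewrite ge0_ler_powR ?nnegrE ?ltW// subr_gt0.
Qed.

Context (I : finType) (Q : I -> set T).
Hypothesis mQ : forall i, measurable (Q i).
Hypothesis LQ : laminar Q.

Lemma max_level (P : pred I) (k : I -> int) :
  (exists i, P i) -> exists2 i, P i & forall j, P j -> k j <= k i.
Proof. by move=> [i0 Pi0]; case: (@arg_maxP _ _ _ i0 P k Pi0) => i Pi H; exists i. Qed.

(* The levels of the stopping sets through a point are distinct integers, so
   geometric sums are dominated by their largest term; after [energy_pointwise]
   half of the left-hand side is absorbed. *)
Lemma stop_energy (k : I -> int) (q : R) (g sigma : T -> R) (S : I -> R) :
  1 < q -> antitone (sub Q) k ->
  measurable_fun setT g -> measurable_fun setT sigma ->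
  (forall x, 0 <= g x) -> (forall x, 0 < sigma x) ->
  (forall i, \int[mu]_(x in Q i) (sigma x)%:E = (S i)%:E)%E ->
  (forall i, stop (sub Q) k i ->
     ((expR (k i)%:~R * S i)%:E <= \int[mu]_(x in Q i) (g x)%:E)%E) ->
  ((\sum_(i | stop (sub Q) k i) expR (q * (k i)%:~R) * S i)%:E <=
   (energy_const q)%:E * \int[mu]_x (g x `^ q * sigma x `^ (1 - q))%:E)%E.
Proof.
move=> q1 ak mg ms g0 s0 sS kg; set N := (\int[mu]_x _)%E.
have S0 i : 0 <= S i.
  by rewrite -lee_fin -sS; apply: integral_ge0 => x _; rewrite lee_fin ltW.
set st := stop (sub Q) k.
set X := \sum_(i | _) _.
pose c := (1 - expR (- (q - 1)))^-1.
have c0 : 0 < c by rewrite invr_gt0 subr_gt0 expR_lt1 oppr_lt0 subr_gt0.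
have mN : measurable_fun setT (fun x => g x `^ q * sigma x `^ (1 - q)).
  by apply: measurable_funM; exact: (measurableT_comp (measurable_powR _)).
have N0 : (0 <= N)%E.
  by apply: integral_ge0 => x _; rewrite lee_fin mulr_ge0 ?powR_ge0.
have eq0 : 0 < energy_const q by rewrite powR_gt0// mulr_gt0.
(* Splitting off one factor [expR (k i)] turns [S i] into the mass of [g] on the stopping set. *)
have step1 : (X%:E <= \int[mu]_x
    ((\sum_(i | st i && (x \in Q i)) expR ((q - 1) * (k i)%:~R)) * g x)%:E)%E.
  rewrite integral_step//.
  rewrite /X -sumEFin; apply: lee_sum => i si.
  have -> : expR (q * (k i)%:~R) * S i =
      expR ((q - 1) * (k i)%:~R) * (expR (k i)%:~R * S i).
    by rewrite mulrA -expRD; congr (expR _ * _); ring.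
  by rewrite EFinM lee_wpmul2l ?lee_fin ?expR_ge0//; exact: kg.
pose F x := ((\sum_(i | st i && (x \in Q i)) 2^-1 * expR (q * (k i)%:~R)) * sigma x)%:E.
pose G x := ((2^-1 * energy_const q) * (g x `^ q * sigma x `^ (1 - q)))%:E.
have F0 x : (0 <= F x)%E.
  rewrite lee_fin; apply: mulr_ge0; last exact: ltW.
  by apply: sumr_ge0 => i _; rewrite mulr_ge0 ?expR_ge0.
have G0 x : (0 <= G x)%E.
  by rewrite lee_fin mulr_ge0 ?mulr_ge0 ?powR_ge0// ltW.
have mF : measurable_fun setT F by apply/measurable_EFinP/measurable_funM => //; exact: measurable_step.
have mG : measurable_fun setT G by apply/measurable_EFinP/measurable_funM.
(* At each point, [E] is the exponential of the largest level of a stopping set through it. *)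
have step2 : (\int[mu]_x
    ((\sum_(i | st i && (x \in Q i)) expR ((q - 1) * (k i)%:~R)) * g x)%:E <=
    \int[mu]_x (F x + G x))%E.
  apply: ge0_le_integral => //.
  - by move=> x _; rewrite lee_fin mulr_ge0// sumr_ge0// => i _; exact: expR_ge0.
  - by apply/measurable_EFinP/measurable_funM => //; exact: measurable_step.
  - exact: emeasurable_funD.
  move=> x _; rewrite -EFinD lee_fin.
  have [none|some] := pselect (forall i, ~~ (st i && (x \in Q i))).
    rewrite big_pred0 ?mul0r; last by move=> i; exact/negbTE.
    by have := adde_ge0 (F0 x) (G0 x); rewrite -EFinD lee_fin.
  have [i Pi imax] : exists2 i, st i && (x \in Q i) &
      forall j, st j && (x \in Q j) -> k j <= k i.
    apply: max_level; apply: contrapT => H; apply: some => i.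
    by apply/negP => Pi; apply: H; exists i.
  have H1 : \sum_(i | st i && (x \in Q i)) expR ((q - 1) * (k i)%:~R) <=
      c * expR ((k i)%:~R) `^ (q - 1).
    rewrite -expRM [_%:~R * _]mulrC.
    apply: (sum_expR_inj _ _ imax); first by rewrite subr_gt0.
    exact: stop_level_inj.
  have H2 : 2^-1 * expR (k i)%:~R `^ q <=
      \sum_(i | st i && (x \in Q i)) 2^-1 * expR (q * (k i)%:~R).
    rewrite (bigD1 i)//= -expRM [_%:~R * _]mulrC lerDl.
    by apply: sumr_ge0 => j _; rewrite mulr_ge0 ?expR_ge0.
  apply: (le_trans (ler_wpM2r (g0 x) H1)).
  apply: le_trans (energy_pointwise q1 c0 (expR_gt0 _) (s0 x) (g0 x)) _.
  rewrite /energy_const -/c; apply: lerD; last by rewrite -(mulrA _ (_ `^ q)).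
  by rewrite mulrA; apply: ler_wpM2r => //; exact: ltW.
have FX : (\int[mu]_x F x = (2^-1 * X)%:E)%E.
  rewrite integral_step//; last by move=> x; exact: ltW.
  rewrite /X big_distrr/= -sumEFin; apply: eq_bigr => i _.
  by rewrite sS -EFinM mulrA.
have GN : (\int[mu]_x G x = (2^-1 * energy_const q)%:E * N)%E.
  rewrite /G; under eq_integral do rewrite EFinM.
  rewrite ge0_integralZl_EFin//; first by move=> x _; rewrite lee_fin mulr_ge0 ?powR_ge0.
    exact/measurable_EFinP.
  by rewrite mulr_ge0// ltW.
(* [X] is a real number, so the half of it on the right can be absorbed; for infinite [N] the bound
   is trivial. *)
have := le_trans step1 step2.
rewrite ge0_integralD// FX GN.
clear GN; move: N0; case: N => [N| |]; last by rewrite leeNy_eq.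
  rewrite lee_fin -EFinM -EFinD !lee_fin => N0; lra.
by move=> _ _; rewrite gt0_muley ?lte_fin// leey.
Qed.

(** The factors come from the packing of [V], from rounding the logarithm to an integer, and from a
    geometric series over levels. *)
Definition kolmogorov_const (al : R) := 2 * expR al * (1 - expR (- (1 - al)))^-1.

(** Each set is counted under a stopping ancestor of its own level. *)
Lemma stop_cover (k : I -> int) (phi : I -> R) : (forall i, 0 <= phi i) ->
  \sum_i phi i <= \sum_(j | stop (sub Q) k j) \sum_(i | sub Q i j && (k i == k j)) phi i.
Proof.
move=> phi0; rewrite (exchange_big_dep predT)//=; apply: ler_sum => i _.
have [j [ij kij sj]] := stop_above (@sub_refl _ _ Q) (@sub_trans _ _ Q) (sub_anti LQ) k i.
by rewrite (bigD1 j) ?sj ?ij ?kij ?eqxx//= lerDl sumr_ge0.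
Qed.

(* With the averages normalised by that of the top set [r], all levels are
   nonnegative. *)
Lemma kolmogorov (sigma : T -> R) (S V : I -> R) (r : I) (al : R) :
  0 < al < 1 -> measurable_fun setT sigma -> (forall x, 0 <= sigma x) ->
  (forall i, \int[mu]_(x in Q i) (sigma x)%:E = (S i)%:E)%E ->
  (forall i, 0 < S i) -> (forall i, 0 < V i) -> (forall i, sub Q i r) ->
  (forall j, \sum_(i | sub Q i j) V i <= 2 * V j) ->
  \sum_i ((S i / V i) / (S r / V r)) `^ al * V i <= kolmogorov_const al * V r.
Proof.
move=> /andP[al0 al1] ms s0 sS S0 V0 ir VC.
set rho := fun i => (S i / V i) / (S r / V r).
have rho0 i : 0 < rho i by rewrite !divr_gt0.
have [k [ak klt kst k0]] := level_exists (@sub_refl _ _ Q) (@sub_trans _ _ Q) rho0.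
have {}k0 i : 0 <= k i.
  apply: (k0 i r (ir i)); rewrite /rho divff// gt_eqF// divr_gt0//.
set st := stop (sub Q) k.
(* Inside the group of [j] the ratios [rho] are at most [expR (k j + 1)], and packing sums the [V i]
   to at most twice [V j]. *)
have E : \sum_i rho i `^ al * V i <=
    \sum_(j | st j) 2 * expR al * (expR (al * (k j)%:~R) * V j).
  apply: (le_trans (stop_cover k _)).
    by move=> i; rewrite mulr_ge0 ?powR_ge0// ltW.
  apply: ler_sum => j sj.
  apply: (@le_trans _ _ (\sum_(i | sub Q i j) expR al * expR (al * (k j)%:~R) * V i)).
    rewrite big_mkcondr/=; apply: ler_sum => i ij.
    case: ifPn => [/eqP kij|_]; last by rewrite !mulr_ge0 ?expR_ge0// ltW.
    rewrite ler_wpM2r//; first exact: ltW.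
    rewrite -expRD (_ : al + _ = ((k i)%:~R + 1) * al); last by rewrite kij; ring.
    rewrite expRM ge0_ler_powR ?nnegrE ?expR_ge0// ltW//.
    by apply: klt; exact: sub_refl.
  rewrite -big_distrr/=.
  have -> : 2 * expR al * (expR (al * (k j)%:~R) * V j) =
    expR al * expR (al * (k j)%:~R) * (2 * V j) by ring.
  by rewrite ler_wpM2l ?mulr_ge0 ?expR_ge0.
apply: (le_trans E); rewrite -big_distrr/= /kolmogorov_const -!mulrA !ler_wpM2l ?expR_ge0//.
(* At a stopping set [expR (k j) <= rho j] trades [V j] for [S j] and leaves the negative exponent
   [- (1 - al)]. *)
have E2 : \sum_(j | st j) expR (al * (k j)%:~R) * V j <=
   (\sum_(j | st j) expR (- (1 - al) * (k j)%:~R) * S j) * (V r / S r).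
  rewrite big_distrl/=; apply: ler_sum => j sj.
  have -> : expR (al * (k j)%:~R) = expR (- (1 - al) * (k j)%:~R) * expR (k j)%:~R.
    by rewrite -expRD; congr expR; ring.
  rewrite -!mulrA ler_wpM2l ?expR_ge0//.
  have -> : S j * (V r / S r) = rho j * V j.
    by rewrite /rho; field; rewrite !gt_eqF.
  by rewrite ler_wpM2r ?kst// ltW.
apply: (le_trans E2).
set c := (1 - _)^-1.
suff H : \sum_(j | st j) expR (- (1 - al) * (k j)%:~R) * S j <= c * S r.
  apply: (le_trans (ler_wpM2r _ H)); first by rewrite ltW// divr_gt0.
  by rewrite -mulrA [S r * _]mulrC divfK// gt_eqF.
(* Written as an integral against [sigma], the sum is pointwise a geometric series: the levels
   through a point are distinct and nonnegative. *)
rewrite -lee_fin -sumEFin.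
under eq_bigr do rewrite EFinM -sS.
rewrite -integral_step//.
rewrite EFinM -sS.
have c0 : 0 < c by rewrite invr_gt0 subr_gt0 expR_lt1 oppr_lt0 subr_gt0.
have mE : measurable_fun (Q r) (EFin \o sigma).
  by apply/measurable_EFinP/measurable_funTS.
rewrite -ge0_integralZl_EFin//; [|by move=> x _; rewrite lee_fin|exact: ltW].
rewrite [leRHS]integral_mkcond.
apply: ge0_le_integral => //.
- by move=> x _; rewrite lee_fin mulr_ge0// sumr_ge0// => i _; exact: expR_ge0.
- apply/measurable_EFinP/measurable_funM => //.
  exact: measurable_step.
- by apply: (measurable_restrictT _ (mQ r)).1; exact: measurable_funeM.
move=> x _; rewrite patchE; case: ifPn => [xr|/negP xr]; last first.
  rewrite big_pred0 ?mul0r// => i; apply/negbTE/negP => /andP[_ xi]; apply: xr.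
  by move: xi; rewrite !inE; have /asboolP := ir i; apply.
rewrite -EFinM lee_fin ler_wpM2r//.
rewrite (eq_bigr (fun i => expR ((1 - al) * (- k i)%:~R))); last first.
  by move=> i _; congr expR; rewrite rmorphN/=; ring.
rewrite -[c]mulr1 -[X in _ * X]expR0 -[X in expR X](mulr0 (1 - al)).
apply: (@sum_expR_inj _ _ _ (fun i => - k i) _ 0); first by rewrite subr_gt0.
  by move=> i j Pi Pj /oppr_inj; exact: (stop_level_inj LQ ak Pi Pj).
by move=> i _; rewrite oppr_le0.
Qed.

End stopping_energy.

(** * The corona decomposition *)

Section core.
Context d (T : measurableType d) {R : realType} (mu : {measure set T -> \bar R}).

(** Over stopping sets the energy costs no Carleson constant. The full family is then grouped under
    stopping sets of equal level, and each group packs with constant [Lam]. *)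
Lemma level_energy (I : finType) (Q : I -> set T) (q Lam N : R)
    (g sigma : T -> R) (S G : I -> R) :
  (forall i, measurable (Q i)) -> laminar Q -> 1 < q ->
  measurable_fun setT g -> measurable_fun setT sigma ->
  (forall x, 0 <= g x) -> (forall x, 0 < sigma x) ->
  (forall i, \int[mu]_(x in Q i) (sigma x)%:E = (S i)%:E)%E ->
  (forall i, \int[mu]_(x in Q i) (g x)%:E = (G i)%:E)%E ->
  (forall i, 0 < S i) -> (forall i, 0 < G i) ->
  0 <= Lam -> (forall j, \sum_(i | sub Q i j) S i <= Lam * S j) ->
  (\int[mu]_x (g x `^ q * sigma x `^ (1 - q))%:E = N%:E)%E ->
  exists k : I -> int, [/\ antitone (sub Q) k,
    forall i, G i / S i <= expR ((k i)%:~R + 1),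
    \sum_(i | stop (sub Q) k i) expR (q * (k i)%:~R) * S i <= energy_const q * N &
    \sum_i expR (q * (k i)%:~R) * S i <= Lam * (energy_const q * N)].
Proof.
move=> mQ LQ q1 mg ms g0 s0 sS gG S0 G0 Lam0 SL NE.
have a0 i : 0 < G i / S i by exact: divr_gt0.
have [k [ak klt kst _]] := level_exists (@sub_refl _ _ Q) (@sub_trans _ _ Q) a0.
have E1 : \sum_(i | stop (sub Q) k i) expR (q * (k i)%:~R) * S i <= energy_const q * N.
  rewrite -lee_fin EFinM -NE; apply: stop_energy => // i si.
  by rewrite gG lee_fin -ler_pdivlMr// kst.
exists k; split => //.
  by move=> i; apply/ltW/klt; exact: sub_refl.
apply: le_trans (ler_wpM2l Lam0 E1).
apply: (le_trans (stop_cover LQ k _)).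
  by move=> i; rewrite mulr_ge0 ?expR_ge0// ltW.
rewrite big_distrr/=; apply: ler_sum => j sj.
rewrite mulrCA; apply: le_trans (ler_wpM2l (expR_ge0 _) (SL j)).
rewrite big_distrr/= big_mkcondr/=; apply: ler_sum => i ij.
case: ifPn => [/eqP ->//|_].
by rewrite mulr_ge0 ?expR_ge0// ltW.
Qed.

(** The averages [G i / S i] are at most [expR (k i + 1)], so the level energy of the whole family
    gives the embedding; rounding costs [expR q]. *)
Lemma carleson_embedding (I : finType) (Q : I -> set T) (q Lam N : R)
    (g sigma : T -> R) (S G : I -> R) :
  (forall i, measurable (Q i)) -> laminar Q -> 1 < q ->
  measurable_fun setT g -> measurable_fun setT sigma ->
  (forall x, 0 <= g x) -> (forall x, 0 < sigma x) ->
  (forall i, \int[mu]_(x in Q i) (sigma x)%:E = (S i)%:E)%E ->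
  (forall i, \int[mu]_(x in Q i) (g x)%:E = (G i)%:E)%E ->
  (forall i, 0 < S i) -> (forall i, 0 < G i) ->
  0 <= Lam -> (forall j, \sum_(i | sub Q i j) S i <= Lam * S j) ->
  (\int[mu]_x (g x `^ q * sigma x `^ (1 - q))%:E = N%:E)%E ->
  \sum_i (G i / S i) `^ q * S i <= expR q * energy_const q * (Lam * N).
Proof.
move=> mQ LQ q1 mg ms g0 s0 sS gG S0 G0 Lam0 SL NE.
have [k [_ klt _ kE]] := level_energy mQ LQ q1 mg ms g0 s0 sS gG S0 G0 Lam0 SL NE.
have -> : expR q * energy_const q * (Lam * N) = expR q * (Lam * (energy_const q * N)) by ring.
apply: le_trans (ler_wpM2l (expR_ge0 _) kE).
rewrite big_distrr/=; apply: ler_sum => i _.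
rewrite mulrA -expRD; apply: ler_wpM2r; first exact: ltW.
have -> : q + q * (k i)%:~R = ((k i)%:~R + 1) * q by ring.
rewrite expRM ge0_ler_powR ?nnegrE ?expR_ge0//.
- by rewrite ltW// (lt_trans _ q1).
- by rewrite ltW// divr_gt0.
Qed.

(** * Several pairs of function and weight at once *)

Section multilinear.
Context (L : finType).
Hypothesis L0 : (0 < #|L|)%N.
Implicit Types (I : finType) (th al be : L -> R).

Lemma sum_gt0 th : (forall l, 0 < th l) -> 0 < \sum_l th l.
Proof.
have /card_gt0P[l0 _] := L0.
by move=> th0; rewrite (bigD1 l0)//= ltr_wpDr// sumr_ge0// => l _; exact: ltW.
Qed.

Lemma sum_below I (Q : I -> set T) (phi : I -> R) j :
  \sum_(i | sub Q i j) phi i =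
  \sum_(i < #|[pred i | sub Q i j]|) phi (enum_val i).
Proof. by rewrite -big_enum_val; apply: eq_bigl => i; rewrite inE. Qed.

(** Carleson and packing conditions survive passing to a subfamily, here reindexed by an ordinal,
    because all summands are nonnegative. *)
Lemma sum_restrict_le I (Q : I -> set T) (A : {pred I}) (phi : I -> R) (c : R) :
  (forall i, 0 <= phi i) ->
  (forall j, \sum_(i | sub Q i j) phi i <= c * phi j) ->
  forall j : 'I_#|A|, \sum_(i | sub (Q \o enum_val) i j) phi (enum_val i) <=
    c * phi (enum_val j).
Proof.
move=> phi0 H j; apply: le_trans (H (enum_val j)).
rewrite -(big_enum_val_cond (fun i => sub Q i (enum_val j)) phi).
rewrite [leLHS]big_mkcondl/=; apply: ler_sum => i _; case: ifP => // _; exact: phi0.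
Qed.

(** AM-GM with weights [al l / a] bounds the product of normalised ratios by a convex combination of
    single powers [rho l i ^ a], each of which falls under [kolmogorov] since [a < 1]. *)
Lemma kolmogorov_prod I (Q : I -> set T) (sigma : L -> T -> R) (S : L -> I -> R)
    (V : I -> R) al j :
  (forall i, measurable (Q i)) -> laminar Q ->
  (forall l, 0 < al l) -> \sum_l al l < 1 ->
  (forall l, measurable_fun setT (sigma l)) -> (forall l x, 0 < sigma l x) ->
  (forall l i, \int[mu]_(x in Q i) (sigma l x)%:E = (S l i)%:E)%E ->
  (forall l i, 0 < S l i) -> (forall i, 0 < V i) ->
  (forall j, \sum_(i | sub Q i j) V i <= 2 * V j) ->
  \sum_(i | sub Q i j) (\prod_l (S l i / V i) `^ al l) * V i <=
  kolmogorov_const (\sum_l al l) * ((\prod_l (S l j / V j) `^ al l) * V j).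
Proof.
move=> mQ LQ al0 al1 ms s0 sS S0 V0 VC.
set a := \sum_l al l.
have a0 : 0 < a by exact: sum_gt0.
pose rho l i := (S l i / V i) / (S l j / V j).
have rho0 l i : 0 < rho l i by rewrite !divr_gt0.
have E i : (\prod_l (S l i / V i) `^ al l) * V i =
   (\prod_l (S l j / V j) `^ al l) * ((\prod_l rho l i `^ al l) * V i).
  rewrite mulrA -big_split/=; congr (_ * _); apply: eq_bigr => l _.
  rewrite -powRM; last 2 first.
  - by rewrite ltW// divr_gt0.
  - exact: ltW.
  by congr (_ `^ _); rewrite /rho; field; rewrite !gt_eqF.
rewrite (eq_bigr _ (fun i _ => E i)) -big_distrr/= mulrCA.
apply: ler_wpM2l; first by apply: prodr_ge0 => l _; exact: powR_ge0.
apply: (@le_trans _ _ (\sum_(i | sub Q i j) \sum_l (al l / a) * (rho l i `^ a * V i))).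
  apply: ler_sum => i _.
  under [leRHS]eq_bigr do rewrite mulrA.
  rewrite -big_distrl/=; apply: ler_wpM2r; first exact: ltW.
  rewrite (eq_bigr (fun l => (rho l i `^ a) `^ (al l / a))); last first.
    by move=> l _; rewrite -powRrM mulrC divfK// gt_eqF.
  apply: prod_powR_le_sum => [l|//|l]; [exact: divr_gt0| |exact: powR_ge0].
  by rewrite -big_distrl/= divff// gt_eqF.
rewrite exchange_big/=.
have -> : kolmogorov_const a * V j = \sum_l (al l / a) * (kolmogorov_const a * V j).
  by rewrite -!big_distrl/= divff ?mul1r// gt_eqF.
apply: ler_sum => l _; rewrite -big_distrr/=.
apply: ler_wpM2l; first by rewrite ltW// divr_gt0.
rewrite sum_below; set A := [pred i | sub Q i j].
have jA : j \in A by exact: sub_refl.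
pose r := enum_rank_in jA j.
have rj : enum_val r = j by exact: enum_rankK_in.
rewrite /rho -[in leRHS]rj.
under eq_bigr do rewrite -[X in _ / (S l X / V X)]rj.
apply: (@kolmogorov _ T R mu _ (Q \o enum_val) _ _ (sigma l) (S l \o enum_val) (V \o enum_val) r) => //=.
- exact: laminar_comp enum_val_inj LQ.
- by rewrite a0 al1.
- by move=> x; exact: ltW.
- by move=> i; rewrite /sub/= rj; have := enum_valP i; rewrite /A inE.
- apply: sum_restrict_le => //; by move=> i; exact: ltW.
Qed.

(** The hypothesis on [tau] is the testing condition. Freezing the levels reduces the sum to the
    stopping sets of the total level, and at each of them one index [l] has jumped; its energy then
    costs no [Lam l]. *)
Lemma corona I (Q : I -> set T) (sigma g : L -> T -> R) (S G : L -> I -> R)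
    (tau : I -> R) th (q Lam N : L -> R) (Tc : R) :
  (forall i, measurable (Q i)) -> laminar Q -> (forall l, 1 < q l) ->
  (forall l, measurable_fun setT (g l)) -> (forall l, measurable_fun setT (sigma l)) ->
  (forall l x, 0 <= g l x) -> (forall l x, 0 < sigma l x) ->
  (forall l i, \int[mu]_(x in Q i) (sigma l x)%:E = (S l i)%:E)%E ->
  (forall l i, \int[mu]_(x in Q i) (g l x)%:E = (G l i)%:E)%E ->
  (forall l i, 0 < S l i) -> (forall l i, 0 < G l i) ->
  (forall l, 0 <= Lam l) ->
  (forall l j, \sum_(i | sub Q i j) S l i <= Lam l * S l j) ->
  (forall l, \int[mu]_x (g l x `^ q l * sigma l x `^ (1 - q l))%:E = (N l)%:E)%E ->
  (forall l, 0 < th l) -> \sum_l th l = 1 ->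
  (forall i, 0 <= tau i) -> 0 <= Tc ->
  (forall j, \sum_(i | sub Q i j) tau i <= Tc * \prod_l S l j `^ th l) ->
  \sum_i (\prod_l (G l i / S l i) `^ (q l * th l)) * tau i <=
  expR (\sum_l q l * th l) * Tc * (\prod_l energy_const (q l) `^ th l) *
  (\sum_l \prod_(l' | l' != l) Lam l' `^ th l') * \prod_l N l `^ th l.
Proof.
move=> mQ LQ q1 mg ms g0 s0 sS gG S0 G0 Lam0 SL NE th0 th1 tau0 Tc0 tauT.
have /choice[k kP] : forall l, exists k : I -> int, [/\ antitone (sub Q) k,
    forall i, G l i / S l i <= expR ((k i)%:~R + 1),
    \sum_(i | stop (sub Q) k i) expR (q l * (k i)%:~R) * S l i <= energy_const (q l) * N l &
    \sum_i expR (q l * (k i)%:~R) * S l i <= Lam l * (energy_const (q l) * N l)].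
  by move=> l; apply: (@level_energy _ _ _ _ _ (g l) (sigma l)).
have N0 l : 0 <= N l.
  by rewrite -lee_fin -NE; apply: integral_ge0 => x _; rewrite lee_fin mulr_ge0 ?powR_ge0.
have ak l : antitone (sub Q) (k l) by have [] := kP l.
(* One integer stands for the vector of levels, by [antitone_sum_eq]. *)
pose K i := \sum_l k l i.
pose e l i := expR (q l * (k l i)%:~R).
have e0 l i : 0 < e l i by exact: expR_gt0.
set E := expR _.
have step1 : \sum_i (\prod_l (G l i / S l i) `^ (q l * th l)) * tau i <=
    E * \sum_i (\prod_l e l i `^ th l) * tau i.
  rewrite big_distrr/=; apply: ler_sum => i _.
  rewrite mulrA; apply: ler_wpM2r => //.
  rewrite /E expR_sum -big_split/=; apply: ler_prod => l _.
  rewrite powR_ge0/= /e -expRM -expRD.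
  have -> : q l * th l + q l * (k l i)%:~R * th l = ((k l i)%:~R + 1) * (q l * th l) by ring.
  rewrite expRM ge0_ler_powR ?nnegrE ?expR_ge0//.
  - by rewrite mulr_ge0// ltW// (lt_trans _ (q1 l)).
  - by rewrite ltW// divr_gt0.
  - by have [] := kP l.
have eK l i j : k l i = k l j -> e l i = e l j by rewrite /e => ->.
have eS l : \sum_(i | stop (sub Q) (k l) i) e l i * S l i <= energy_const (q l) * N l.
  by have [] := kP l.
have eA l : \sum_i e l i * S l i <= Lam l * (energy_const (q l) * N l) by have [] := kP l.
clearbody e.
(* Below a stopping set, constant [K] means constant [e l] for every [l], so these factors leave the
   inner sum and the testing condition applies. *)
have step2 : \sum_i (\prod_l e l i `^ th l) * tau i <=
    Tc * \sum_(j | stop (sub Q) K j) \prod_l (e l j * S l j) `^ th l.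
  apply: (le_trans (stop_cover LQ K _)).
    by move=> i; rewrite mulr_ge0// prodr_ge0// => l _; exact: powR_ge0.
  rewrite big_distrr/=; apply: ler_sum => j sj.
  apply: (@le_trans _ _ ((\prod_l e l j `^ th l) * \sum_(i | sub Q i j) tau i)).
    rewrite mulr_sumr [leLHS]big_mkcondr; apply: ler_sum => i ij.
    case: ifPn => [/eqP Kij|_]; last first.
      by rewrite mulr_ge0// prodr_ge0// => l _; exact: powR_ge0.
    have kij := antitone_sum_eq ak ij (esym Kij).
    suff -> : \prod_l e l i `^ th l = \prod_l e l j `^ th l by exact: lexx.
    by apply: eq_bigr => l _; rewrite (eK _ _ _ (kij l)).
  under [in leRHS]eq_bigr do rewrite powRM ?(ltW (e0 _ _))// ?(ltW (S0 _ _))//.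
  rewrite big_split/= mulrCA; apply: ler_wpM2l => //.
  by apply: prodr_ge0 => l _; exact: powR_ge0.
(* Each stopping set of [K] is charged to an index whose own level jumps there. *)
have step3 : \sum_(j | stop (sub Q) K j) \prod_l (e l j * S l j) `^ th l <=
    \sum_l \sum_(j | stop (sub Q) (k l) j) \prod_l (e l j * S l j) `^ th l.
  rewrite (exchange_big_dep predT)//=.
  rewrite [leLHS]big_mkcond/=; apply: ler_sum => j _.
  have P0 : 0 <= \prod_l (e l j * S l j) `^ th l.
    by apply: prodr_ge0 => l _; exact: powR_ge0.
  case: ifPn => sj; last by apply: sumr_ge0.
  have [l sl] := stop_sum (@sub_refl _ _ Q) (@sub_trans _ _ Q) (sub_anti LQ)
    (@sub_chain _ _ _ LQ) L0 ak sj.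
  by rewrite [leRHS](bigD1 l)//= lerDl sumr_ge0.
(* After Hoelder, the factor [l] is a sum over its own stopping sets; the others are enlarged to the
   whole family at the price of [Lam l']. *)
have step4 l : \sum_(j | stop (sub Q) (k l) j) \prod_l (e l j * S l j) `^ th l <=
   (\prod_l energy_const (q l) `^ th l) * (\prod_(l' | l' != l) Lam l' `^ th l') * \prod_l N l `^ th l.
  have ES0 l' j : 0 <= e l' j * S l' j by rewrite ltW// mulr_gt0.
  apply: (le_trans (sum_prod_powR_le _ th0 th1 ES0)).
  rewrite [X in _ <= _ * X * _](_ : _ = \prod_l' (if l' != l then Lam l' else 1) `^ th l'); last first.
    by rewrite big_mkcond/=; apply: eq_bigr => l' _; case: ifP => //; rewrite powR1.
  rewrite -!big_split/=; apply: ler_prod => l' _; rewrite powR_ge0/=.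
  have C0 : 0 <= energy_const (q l') by exact: powR_ge0.
  have Lam0' : 0 <= if l' != l then Lam l' else 1 by case: ifP.
  rewrite -powRM// -powRM ?mulr_ge0//.
  rewrite ge0_ler_powR ?nnegrE ?mulr_ge0 ?sumr_ge0//; first exact: ltW.
  case: ifPn => [ll'|/negPn/eqP ll']; last by rewrite mulr1 -ll' eS.
  apply: (@le_trans _ _ (\sum_i e l' i * S l' i)).
    by rewrite [leLHS]big_mkcond/=; apply: ler_sum => i _; case: ifP.
  by rewrite [leRHS]mulrAC [leRHS]mulrC eA.
have E0 : 0 <= E by exact: expR_ge0.
apply: (le_trans step1); rewrite -!mulrA; apply: ler_wpM2l => //.
apply: (le_trans step2); apply: ler_wpM2l => //.
apply: (le_trans step3).
rewrite big_distrl/= big_distrr/=; apply: ler_sum => l _.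
by apply: (le_trans (step4 l)); rewrite !mulrA.
Qed.

End multilinear.
End core.

(** * Slices of the local [A_R] quantity and the two exponent regimes *)

Section slices.
Context d (T : measurableType d) {R : realType} (mu : {measure set T -> \bar R}).
Context (L : finType).
Hypothesis L0 : (0 < #|L|)%N.
Implicit Types (I : finType) (th be : L -> R).

Lemma prod_powR_unit th (x : L -> R) (v : R) :
  \sum_l th l = 1 -> (forall l, 0 < th l) -> (forall l, 0 < x l) -> 0 < v ->
  (\prod_l (x l / v) `^ th l) * v = \prod_l x l `^ th l.
Proof.
move=> th1 th0 x0 v0.
have {2}-> : v = \prod_l v `^ th l by rewrite prod_powR_sum ?ltW// th1 powRr1// ltW.
rewrite -big_split/=.
by apply: eq_bigr => l _; rewrite -powRM ?divfK ?gt_eqF// ltW// divr_gt0.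
Qed.

Lemma prod_powRD (x a b : L -> R) : (forall l, 0 < x l) ->
  \prod_l x l `^ (a l + b l) = (\prod_l x l `^ a l) * \prod_l x l `^ b l.
Proof.
move=> x0; rewrite -big_split/=; apply: eq_bigr => l _.
by rewrite powRD// (gt_eqF (x0 l)) implybT.
Qed.

Lemma powR_prod I (P : pred I) (x : I -> R) (c : R) : (forall i, 0 <= x i) ->
  (\prod_(i | P i) x i) `^ c = \prod_(i | P i) x i `^ c.
Proof.
move=> x0; apply: (@proj2 (0 <= \prod_(i | P i) x i)).
apply: (big_ind2 (fun a b => 0 <= a /\ a `^ c = b)) => //.
- by rewrite powR1.
- by move=> a b a' b' [a0 <-] [a0' <-]; rewrite powRM// mulr_ge0.
Qed.

(** In each slice the local quantity is comparable to one value [B = A e^-n], and [corona] applies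
    with testing constant of order [B ^ lam]. As [lam > 0], the slices sum geometrically. The ratio
    [t l / th l] is the Lebesgue exponent of the pair [l]. *)
Lemma large_exponent_form th be (lam : R) :
  (forall l, 0 < th l) -> \sum_l th l = 1 -> (forall l, 0 < be l) -> 0 < lam ->
  let t l := th l + lam * be l in
  exists2 C, 0 <= C & forall I (Q : I -> set T) (sigma g : L -> T -> R)
    (S G : L -> I -> R) (V : I -> R) (Lam N : L -> R) (A : R),
  (forall i, measurable (Q i)) -> laminar Q ->
  (forall l, measurable_fun setT (g l)) -> (forall l, measurable_fun setT (sigma l)) ->
  (forall l x, 0 <= g l x) -> (forall l x, 0 < sigma l x) ->
  (forall l i, \int[mu]_(x in Q i) (sigma l x)%:E = (S l i)%:E)%E ->
  (forall l i, \int[mu]_(x in Q i) (g l x)%:E = (G l i)%:E)%E ->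
  (forall l i, 0 < S l i) -> (forall i, 0 < V i) ->
  (forall j, \sum_(i | sub Q i j) V i <= 2 * V j) ->
  (forall l, 0 <= Lam l) ->
  (forall l j, \sum_(i | sub Q i j) S l i <= Lam l * S l j) ->
  (forall l, \int[mu]_x (g l x `^ (t l / th l) * sigma l x `^ (1 - t l / th l))%:E = (N l)%:E)%E ->
  (forall i, \prod_l (S l i / V i) `^ be l <= A) ->
  \sum_i (\prod_l (G l i / V i) `^ t l) * V i <=
  C * A `^ lam * (\sum_l \prod_(l' | l' != l) Lam l' `^ th l') * \prod_l N l `^ th l.
Proof.
move=> th0 th1 be0 lam0 t.
have t0 l : 0 < t l by rewrite addr_gt0// mulr_gt0.
have q1 l : 1 < t l / th l.
  by rewrite ltr_pdivlMr// mul1r ltrDl mulr_gt0.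
have bt0 l : 0 < be l / th l by exact: divr_gt0.
pose s := \sum_l be l / th l; have s0 : 0 < s by exact: sum_gt0.
(* [eps] keeps every [al l >= th l / 2], while [sum al < 1] allows
   [kolmogorov_prod]. *)
pose eps := 2^-1 / s; have eps0 : 0 < eps by rewrite divr_gt0.
pose al l := th l - eps * be l.
have al0 l : 0 < al l.
  have H : be l <= s * th l.
    by rewrite -ler_pdivrMr// /s (bigD1 l)//= lerDl sumr_ge0// => l' _; exact: ltW.
  have : eps * be l <= 2^-1 * th l.
    by apply: (le_trans (ler_wpM2l (ltW eps0) H)); rewrite /eps mulrA divfK// gt_eqF.
  by have := th0 l; rewrite /al; lra.
have alS : \sum_l al l = 1 - eps * \sum_l be l by rewrite sumrB th1 big_distrr.
have al1 : \sum_l al l < 1 by rewrite alS ltrBlDr ltrDl mulr_gt0// sum_gt0.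
pose K := kolmogorov_const (\sum_l al l).
have K0 : 0 <= K.
  by rewrite /K /kolmogorov_const !mulr_ge0 ?expR_ge0// invr_ge0 subr_ge0 expR_le1 oppr_le0 subr_ge0 ltW.
pose C1 := expR (\sum_l t l) * (K * expR eps) * \prod_l energy_const (t l / th l) `^ th l.
have C10 : 0 <= C1.
  apply: mulr_ge0; last by apply: prodr_ge0 => l _; exact: powR_ge0.
  by apply: mulr_ge0; [|apply: mulr_ge0]; rewrite ?expR_ge0.
have c0 : 0 <= (1 - expR (- lam))^-1 by rewrite invr_ge0 subr_ge0 expR_le1 oppr_le0 ltW.
exists (C1 * (1 - expR (- lam))^-1); first by rewrite mulr_ge0.
move=> I Q sigma g S G V Lam N A mQ LQ mg ms g0 s0' sS gG S0 V0 VC Lam0 SL NE SA.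
have SV0 l i : 0 < S l i / V i by exact: divr_gt0.
pose a i := \prod_l (S l i / V i) `^ be l.
have a0 i : 0 < a i by apply: prodr_gt0 => l _; exact: powR_gt0.
have [i0 _|I0] := pickP (fun _ : I => true); last first.
  rewrite [leLHS]big_pred0//; apply: mulr_ge0; last by apply: prodr_ge0 => l _; exact: powR_ge0.
  apply: mulr_ge0; first by apply: mulr_ge0; [exact: mulr_ge0|exact: powR_ge0].
  by apply: sumr_ge0 => l _; apply: prodr_ge0 => l' _; exact: powR_ge0.
have A0 : 0 < A by exact: lt_le_trans (a0 i0) (SA i0).
have G0 l i : 0 <= G l i.
  by rewrite -lee_fin -gG; apply: integral_ge0 => x _; rewrite lee_fin.
(* [D i] is the slice index: [a i] lies between [A e^-(D i + 1)] and [A e^-(D i)]. *)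
pose D i := Num.truncn (ln (A / a i)).
have Dx i : 0 <= ln (A / a i) by rewrite ln_ge0// ler_pdivlMr// mul1r SA.
have Aa0 i : 0 < A / a i by exact: divr_gt0.
have aD i : a i <= A * expR (- (D i)%:R).
  rewrite expRN ler_pdivlMr ?expR_gt0// mulrC -ler_pdivlMr//.
  by rewrite -[leRHS]lnK ?posrE// ler_expR truncn_le.
have aD' i : A * expR (- (D i)%:R) * expR (- 1) <= a i.
  rewrite -mulrA -expRD -opprD expRN ler_pdivrMr ?expR_gt0// mulrC -ler_pdivrMr//.
  rewrite -[leLHS]lnK ?posrE// ler_expR ltW// natr1.
  exact: truncnS_gt.
pose Z := (\sum_l \prod_(l' | l' != l) Lam l' `^ th l') * \prod_l N l `^ th l.
have Z0 : 0 <= Z.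
  apply: mulr_ge0; last by apply: prodr_ge0 => l _; exact: powR_ge0.
  by apply: sumr_ge0 => l _; apply: prodr_ge0 => l' _; exact: powR_ge0.
(* Levels are logarithms of averages, so cubes on which some [g l] has zero integral are set aside;
   their terms vanish because [t l > 0]. *)
pose pos i := [forall l, 0 < G l i].
pose term i := (\prod_l (G l i / V i) `^ t l) * V i.
have slice n : \sum_(i | pos i && (D i == n)) term i <= C1 * (A * expR (- n%:R)) `^ lam * Z.
  set B := A * expR (- n%:R).
  have B0 : 0 < B by rewrite mulr_gt0 ?expR_gt0.
  pose Pn := [pred i | pos i && (D i == n)].
  pose h : 'I_#|Pn| -> I := enum_val.
  have hP j : pos (h j) /\ D (h j) = n.
    by have := enum_valP j; rewrite inE => /andP[? /eqP].
  rewrite (_ : \sum_(i | _) _ = \sum_(j < #|Pn|) term (h j)); last first.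
    by rewrite -big_enum_val; apply: eq_bigl => i; rewrite inE.
  (* [tau] is the term with every [g l] replaced by [sigma l]. *)
  pose tau i := (\prod_l (S l i / V i) `^ t l) * V i.
  have tau0 i : 0 <= tau i.
    by rewrite mulr_ge0 ?(ltW (V0 _))// prodr_ge0// => l _; exact: powR_ge0.
  have termE j : term (h j) =
      (\prod_l (G l (h j) / S l (h j)) `^ (t l / th l * th l)) * tau (h j).
    rewrite /term /tau mulrA -big_split/=; congr (_ * _); apply: eq_bigr => l _.
    have GS : 0 <= G l (h j) / S l (h j) by rewrite mulr_ge0 ?invr_ge0// ltW.
    rewrite divfK ?gt_eqF// -powRM ?GS ?(ltW (SV0 _ _))//.
    by rewrite mulrA divfK// gt_eqF.
  rewrite (eq_bigr _ (fun j _ => termE j)).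
  have VC' := sum_restrict_le (A := Pn) (fun i => ltW (V0 i)) VC.
  have LQ' : laminar (Q \o h) by exact: laminar_comp enum_val_inj LQ.
  (* Since [t = (lam + eps) be + al], the upper slice bound extracts [B ^ (lam + eps)]. After
     [kolmogorov_prod], the identity [al = th - eps be] and the lower slice bound return
     [B ^ (- eps)] at the cost of [expR eps]. *)
  have testing j : \sum_(i | sub (Q \o h) i j) tau (h i) <=
      K * expR eps * B `^ lam * \prod_l S l (h j) `^ th l.
    have tauE i : tau (h i) <= B `^ (lam + eps) *
        ((\prod_l (S l (h i) / V (h i)) `^ al l) * V (h i)).
      rewrite /tau mulrA; apply: ler_wpM2r; first exact: ltW.
      rewrite (eq_bigr (fun l => (S l (h i) / V (h i)) `^ (((lam + eps) * be l) + al l))); last first.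
        by move=> l _; congr (_ `^ _); rewrite /t /al; ring.
      rewrite prod_powRD//; apply: ler_wpM2r.
        by apply: prodr_ge0 => l _; exact: powR_ge0.
      under eq_bigr do rewrite [(lam + eps) * _]mulrC powRrM.
      rewrite -powR_prod; last by move=> l; exact: powR_ge0.
      rewrite ge0_ler_powR ?nnegrE ?(ltW B0) ?(ltW (a0 _)) ?(ltW (addr_gt0 lam0 eps0))//.
      by have [_ Dn] := hP i; have := aD (h i); rewrite Dn.
    apply: (le_trans (ler_sum _ _)); first by move=> i _; exact: tauE.
    rewrite -big_distrr/=.
    have := @kolmogorov_prod _ T R mu L L0 _ (Q \o h) sigma (fun l => S l \o h) (V \o h) al j
      (fun i => mQ (h i)) LQ' al0 al1 ms s0' (fun l i => sS l (h i)) (fun l i => S0 l (h i))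
      (fun i => V0 (h i)) VC'.
    move=> /(ler_wpM2l (powR_ge0 B (lam + eps)))/le_trans; apply => /=.
    have SE : (\prod_l (S l (h j) / V (h j)) `^ al l) * V (h j) =
       (\prod_l S l (h j) `^ th l) * a (h j) `^ (- eps).
      rewrite -(@prod_powR_unit th _ (V (h j)))// mulrAC; congr (_ * _).
      rewrite (eq_bigr (fun l => (S l (h j) / V (h j)) `^ (th l + (- eps) * be l))); last first.
        by move=> l _; congr (_ `^ _); rewrite /al; ring.
      rewrite prod_powRD//; congr (_ * _).
      under eq_bigr do rewrite [- eps * _]mulrC powRrM.
      by rewrite -powR_prod// => l; exact: powR_ge0.
    have aB : a (h j) `^ (- eps) <= B `^ (- eps) * expR eps.
      have -> : B `^ (- eps) * expR eps = (B * expR (- 1)) `^ (- eps).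
        by rewrite powRM ?expR_ge0 ?(ltW B0)// -expRM mulrNN mul1r.
      have BE0 : 0 < B * expR (- 1) by rewrite mulr_gt0 ?expR_gt0.
      rewrite !powRN lef_pV2 ?posrE ?powR_gt0//.
      rewrite ge0_ler_powR ?nnegrE ?(ltW BE0) ?(ltW (a0 _)) ?(ltW eps0)//.
      by have [_ Dn] := hP j; have := aD' (h j); rewrite Dn.
    rewrite SE; set P := \prod_l S l (h j) `^ th l.
    have P0 : 0 <= P by apply: prodr_ge0 => l _; exact: powR_ge0.
    have -> : B `^ (lam + eps) * (K * (P * a (h j) `^ (- eps))) =
        (K * B `^ lam * P) * (B `^ eps * a (h j) `^ (- eps)).
      by rewrite powRD ?(gt_eqF B0) ?implybT//; ring.
    have -> : K * expR eps * B `^ lam * P = (K * B `^ lam * P) * expR eps by ring.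
    apply: ler_wpM2l; first by apply: mulr_ge0 => //; apply: mulr_ge0 => //; exact: powR_ge0.
    apply: (le_trans (ler_wpM2l (powR_ge0 _ _) aB)).
    by rewrite mulrA -powRD ?subrr ?powRr0 ?mul1r// (gt_eqF B0) implybT.
  have Tc0 : 0 <= K * expR eps * B `^ lam.
    by apply: mulr_ge0; [apply: mulr_ge0 => //; exact: expR_ge0|exact: powR_ge0].
  have Gh l j : 0 < G l (h j) by have [/forallP] := hP j.
  apply: (le_trans (@corona _ T R mu L L0 _ (Q \o h) sigma g (fun l => S l \o h)
    (fun l => G l \o h) (tau \o h) th (fun l => t l / th l) Lam N _
    (fun i => mQ (h i)) LQ' q1 mg ms g0 s0' (fun l i => sS l (h i)) (fun l i => gG l (h i))
    (fun l i => S0 l (h i)) Gh Lam0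
    (fun l => sum_restrict_le (fun i => ltW (S0 l i)) (SL l)) NE th0 th1
    (fun i => tau0 (h i)) Tc0 testing)).
  rewrite (eq_bigr t); last by move=> l _; rewrite divfK ?gt_eqF.
  by rewrite /C1 /Z le_eqVlt; apply/orP; left; apply/eqP; ring.
have -> : \sum_i (\prod_l (G l i / V i) `^ t l) * V i = \sum_(i | pos i) term i.
  rewrite [RHS]big_mkcond/=; apply: eq_bigr => i _; case: ifPn => // /forallPn[l].
  rewrite -leNgt => Gl0; have /eqP Gl : G l i == 0 by rewrite eq_le Gl0 G0.
  by rewrite (bigD1 l)//= Gl mul0r powR0 ?mul0r// gt_eqF.
(* Finitely many slices are occupied, and their constants form a geometric series of ratio
   [expR (- lam)]. *)
pose M := \max_i D i.
have DM i : (D i < M.+1)%N by rewrite ltnS; exact: leq_bigmax.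
rewrite (partition_big (fun i => Ordinal (DM i)) predT)//=.
apply: (@le_trans _ _ (\sum_(n < M.+1) C1 * A `^ lam * Z * expR (- lam) ^+ n)).
  apply: ler_sum => n _.
  rewrite (eq_bigl (fun i => pos i && (D i == n))); last by move=> i; rewrite -val_eqE.
  apply: (le_trans (slice n)); rewrite powRM ?expR_ge0 ?(ltW A0)//.
  rewrite -expRM -expRM_natr (_ : - n%:R * lam = - lam * n%:R); last by ring.
  by rewrite le_eqVlt; apply/orP; left; apply/eqP; ring.
rewrite -big_distrr/=.
have -> : C1 * (1 - expR (- lam))^-1 * A `^ lam *
    (\sum_l \prod_(l' | l' != l) Lam l' `^ th l') * (\prod_l N l `^ th l) =
    (C1 * A `^ lam * Z) * (1 - expR (- lam))^-1.
  by rewrite /Z; ring.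
apply: ler_wpM2l; first by apply: mulr_ge0 => //; apply: mulr_ge0 => //; exact: powR_ge0.
apply: sum_expr_inj; first by rewrite expR_ge0 expR_lt1 oppr_lt0.
by move=> i j _ _ /val_inj.
Qed.

(** Extracting [A] from every summand leaves a product over [l] of
    [((G l i / S l i) ^ q l * S l i) ^ th l], with [q l = t l / th l]. Hoelder separates the
    weights, and [carleson_embedding] handles each. *)
Lemma small_exponent_form th be :
  (forall l, 0 < th l) -> \sum_l th l = 1 -> (forall l, 0 < be l) ->
  let t l := th l + be l in
  exists2 C, 0 <= C & forall I (Q : I -> set T) (sigma g : L -> T -> R)
    (S G : L -> I -> R) (V W : I -> R) (Lam N : L -> R) (A : R),
  (forall i, measurable (Q i)) -> laminar Q ->
  (forall l, measurable_fun setT (g l)) -> (forall l, measurable_fun setT (sigma l)) ->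
  (forall l x, 0 <= g l x) -> (forall l x, 0 < sigma l x) ->
  (forall l i, \int[mu]_(x in Q i) (sigma l x)%:E = (S l i)%:E)%E ->
  (forall l i, \int[mu]_(x in Q i) (g l x)%:E = (G l i)%:E)%E ->
  (forall l i, 0 < S l i) -> (forall i, 0 < V i) -> (forall i, 0 <= W i) ->
  (forall l, 0 <= Lam l) ->
  (forall l j, \sum_(i | sub Q i j) S l i <= Lam l * S l j) ->
  (forall l, \int[mu]_x (g l x `^ (t l / th l) * sigma l x `^ (1 - t l / th l))%:E = (N l)%:E)%E ->
  0 <= A -> (forall i, W i / V i * \prod_l (S l i / V i) `^ be l <= A) ->
  \sum_i (\prod_l (G l i / V i) `^ t l) * W i <=
  C * A * (\prod_l Lam l `^ th l) * \prod_l N l `^ th l.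
Proof.
move=> th0 th1 be0 t.
have t0 l : 0 < t l by rewrite addr_gt0.
have q1 l : 1 < t l / th l by rewrite ltr_pdivlMr// mul1r ltrDl.
pose c l := expR (t l / th l) * energy_const (t l / th l).
have c0 l : 0 <= c l by rewrite mulr_ge0 ?expR_ge0 ?powR_ge0.
exists (\prod_l c l `^ th l); first by apply: prodr_ge0 => l _; exact: powR_ge0.
move=> I Q sigma g S G V W Lam N A mQ LQ mg ms g0 s0' sS gG S0 V0 W0 Lam0 SL NE A0 SA.
have SV0 l i : 0 < S l i / V i by exact: divr_gt0.
have G0 l i : 0 <= G l i.
  by rewrite -lee_fin -gG; apply: integral_ge0 => x _; rewrite lee_fin.
have N0 l : 0 <= N l.
  by rewrite -lee_fin -NE; apply: integral_ge0 => x _; rewrite lee_fin mulr_ge0 ?powR_ge0.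
pose pos i := [forall l, 0 < G l i].
pose term i := (\prod_l (G l i / V i) `^ t l) * W i.
have -> : \sum_i (\prod_l (G l i / V i) `^ t l) * W i = \sum_(i | pos i) term i.
  rewrite [RHS]big_mkcond/=; apply: eq_bigr => i _; case: ifPn => // /forallPn[l].
  rewrite -leNgt => Gl0; have /eqP Gl : G l i == 0 by rewrite eq_le Gl0 G0.
  by rewrite (bigD1 l)//= Gl mul0r powR0 ?mul0r// gt_eqF.
pose h : 'I_#|pos| -> I := enum_val.
have Gh l j : 0 < G l (h j) by have /forallP := enum_valP j.
have -> : \sum_(i | pos i) term i = \sum_(j < #|pos|) term (h j) by rewrite -big_enum_val.
have LQ' : laminar (Q \o h) by exact: laminar_comp enum_val_inj LQ.
pose q l := t l / th l.
have termE j : term (h j) <=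
    A * \prod_l ((G l (h j) / S l (h j)) `^ q l * S l (h j)) `^ th l.
  have GS l : 0 <= G l (h j) / S l (h j) by rewrite ltW// divr_gt0.
  have -> : term (h j) = (\prod_l (G l (h j) / S l (h j)) `^ t l) *
     ((\prod_l (S l (h j) / V (h j)) `^ t l) * W (h j)).
    rewrite /term mulrA -big_split/=; congr (_ * _); apply: eq_bigr => l _.
    by rewrite -powRM ?GS ?(ltW (SV0 _ _))// mulrA divfK// gt_eqF.
  have -> : \prod_l ((G l (h j) / S l (h j)) `^ q l * S l (h j)) `^ th l =
     (\prod_l (G l (h j) / S l (h j)) `^ t l) * \prod_l S l (h j) `^ th l.
    rewrite -big_split/=; apply: eq_bigr => l _.
    by rewrite powRM ?powR_ge0 ?(ltW (S0 _ _))// -powRrM /q divfK// gt_eqF.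
  rewrite [leRHS]mulrCA; apply: ler_wpM2l; first by apply: prodr_ge0 => l _; exact: powR_ge0.
  rewrite -(@prod_powR_unit th _ (V (h j)))// prod_powRD//.
  set X := \prod_l _ `^ th l; set Y := \prod_l _ `^ be l.
  have -> : X * Y * W (h j) = (W (h j) / V (h j) * Y) * (X * V (h j)).
    by field; rewrite gt_eqF.
  apply: ler_wpM2r; last exact: SA.
  apply: mulr_ge0; last exact: ltW.
  by apply: prodr_ge0 => l _; exact: powR_ge0.
apply: (le_trans (ler_sum _ _)); first by move=> j _; exact: termE.
rewrite -big_distrr/= -[leRHS]mulrA -[leRHS]mulrA [leRHS]mulrCA.
apply: ler_wpM2l => //.
apply: le_trans (sum_prod_powR_le _ th0 th1 _) _.
  by move=> l j; rewrite mulr_ge0 ?powR_ge0// ltW.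
rewrite -!big_split/=; apply: ler_prod => l _; rewrite powR_ge0/=.
have LN0 : 0 <= Lam l * N l by exact: mulr_ge0.
rewrite -powRM// -powRM//.
apply: ge0_ler_powR; rewrite ?nnegrE; [exact: ltW| |exact: mulr_ge0 (c0 l) LN0|].
  by apply: sumr_ge0 => j _; rewrite mulr_ge0 ?powR_ge0// ltW.
exact: (@carleson_embedding _ T R mu _ (Q \o h) (q l) (Lam l) (N l) (g l) (sigma l)
  (S l \o h) (G l \o h) (fun i => mQ (h i)) LQ' (q1 l) (mg l) (ms l) (g0 l) (s0' l)
  (fun i => sS l (h i)) (fun i => gG l (h i)) (fun i => S0 l (h i)) (Gh l) (Lam0 l)
  (sum_restrict_le (fun i => ltW (S0 l i)) (SL l)) (NE l)).
Qed.
End slices.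

(** * Finite sparse operators on a measure space *)

Section finite_families.
Context {R : realType}.

(** Separates the extra pair, indexed by [None], from the [m] original ones. *)
Lemma big_optionE (S : Type) (idx : S) (op : Monoid.com_law idx) (I : finType)
    (P : pred (option I)) (F : option I -> S) :
  \big[op/idx]_(l | P l) F l =
  op (if P None then F None else idx) (\big[op/idx]_(i | P (Some i)) F (Some i)).
Proof.
rewrite (perm_big (None :: [seq Some i | i <- index_enum I]))/=; last first.
  apply: uniq_perm; first exact: index_enum_uniq.
    rewrite /= map_inj_uniq ?index_enum_uniq ?andbT; last by move=> ? ? [].
    by apply/mapP => -[].
  move=> [i|]; rewrite !inE ?mem_index_enum//= mem_map ?mem_index_enum//.
by rewrite big_cons big_map; case: ifP => // _; rewrite Monoid.mul1m.
Qed.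

(** Comparison with the largest summand treats exponents above and below one alike. *)
Lemma powR_sum_card (L : finType) (z : L -> R) (e : R) : 0 < e ->
  (forall l, 0 <= z l) -> (\sum_l z l) `^ e <= #|L|%:R `^ e * \sum_l z l `^ e.
Proof.
move=> e0 z0; have [l0 _|none] := pickP (fun _ : L => true); last first.
  rewrite !big_pred0// powR0 ?mulr0// gt_eqF//.
case: (@arg_maxP _ _ _ l0 predT z isT) => l _ lmax.
apply: (@le_trans _ _ ((#|L|%:R * z l) `^ e)).
  rewrite ge0_ler_powR ?nnegrE ?mulr_ge0 ?sumr_ge0 ?(ltW e0)//.
  rewrite mulr_natl -sumr_const; apply: ler_sum => l' _; exact: lmax.
rewrite powRM//; apply: ler_wpM2l; first exact: powR_ge0.
by rewrite (bigD1 l)//= lerDl sumr_ge0// => l' _; exact: powR_ge0.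
Qed.

Lemma prod_powR_double (L : finType) (P : pred L) (a e : L -> R) :
  (forall l, 0 <= a l) -> (forall l, 0 <= e l) ->
  \prod_(l | P l) (2 * a l) `^ e l <= 2 `^ (\sum_l e l) * \prod_(l | P l) a l `^ e l.
Proof.
move=> a0 e0.
rewrite (eq_bigr (fun l => 2 `^ e l * a l `^ e l)); last by move=> l _; rewrite powRM.
rewrite big_split/=; apply: ler_wpM2r; first by apply: prodr_ge0 => l _; exact: powR_ge0.
have -> : \prod_(l | P l) (2 : R) `^ e l = 2 `^ (\sum_(l | P l) e l).
  elim/big_rec2 : _ => [|l x y _ ->]; first by rewrite powRr0.
  by rewrite powRD// (_ : (2 : R) != 0) ?implybT.
apply: ler_powR; first by rewrite ler1n.
by rewrite [leLHS]big_mkcond/=; apply: ler_sum => l _; case: ifP.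
Qed.

Context d (T : measurableType d) (mu : {measure set T -> \bar R}).

(** Here [th l = p / P l] sums to one, and the exponent of [sigma l] in the [A_R] constant is
    [be l = p / p0 - p / P l]. Thus [t l = p / p0], and [t l / th l] is the exponent [P l / p0] of
    the weighted space. *)
Lemma finite_operator_small (m : nat) (gam p0 p : R) (P : 'I_m -> R) :
  (0 < m)%N -> 0 < gam -> 0 < p0 -> (forall i, p0 < P i) ->
  p^-1 = \sum_(i < m) (P i)^-1 -> p <= gam ->
  exists2 C, 0 <= C & forall (I : finType) (Q : I -> set T) (w : T -> R)
    (sigma g : 'I_m -> T -> R) (Sw V : I -> R) (S G : 'I_m -> I -> R) (a N : 'I_m -> R) (A : R),
  (forall i, measurable (Q i)) -> laminar Q ->
  measurable_fun setT w -> (forall x, 0 < w x) ->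
  (forall l, measurable_fun setT (g l)) -> (forall l, measurable_fun setT (sigma l)) ->
  (forall l x, 0 <= g l x) -> (forall l x, 0 < sigma l x) ->
  (forall i, \int[mu]_(x in Q i) (w x)%:E = (Sw i)%:E)%E ->
  (forall l i, \int[mu]_(x in Q i) (sigma l x)%:E = (S l i)%:E)%E ->
  (forall l i, \int[mu]_(x in Q i) (g l x)%:E = (G l i)%:E)%E ->
  (forall l i, 0 < S l i) -> (forall i, 0 < V i) ->
  (forall l, 0 <= a l) ->
  (forall l j, \sum_(i | sub Q i j) S l i <= 2 * a l * S l j) ->
  (forall l, \int[mu]_x (g l x `^ (P l / p0) * sigma l x `^ (1 - P l / p0))%:E = (N l)%:E)%E ->
  0 <= A ->
  (forall i, Sw i / V i * \prod_l (S l i / V i) `^ (p / p0 / (P l / p0 / (P l / p0 - 1))) <= A) ->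
  (\int[mu]_x ((\sum_(i | x \in Q i) \prod_l (G l i / V i) `^ (gam / p0)) `^ (p / gam) * w x)%:E <=
   ((C * A `^ p^-1 * (\prod_l a l `^ (P l)^-1) * \prod_l N l `^ (P l)^-1) `^ p)%:E)%E.
Proof.
move=> m0 gam0 p00 Pp pE pgam.
have P0 l : 0 < P l by exact: lt_trans (Pp l).
have pV0 : 0 < p^-1 by rewrite pE sum_gt0 ?card_ord// => l; rewrite invr_gt0.
have p_gt0 : 0 < p by rewrite -invr_gt0.
pose th l := p / P l.
pose be l := p / p0 / (P l / p0 / (P l / p0 - 1)).
have th0 l : 0 < th l by exact: divr_gt0.
have th1 : \sum_l th l = 1 by rewrite -big_distrr/= -pE divff// gt_eqF.
have r1 l : 1 < P l / p0 by rewrite ltr_pdivlMr// mul1r.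
have be0 l : 0 < be l by rewrite !divr_gt0// subr_gt0.
have tE l : th l + be l = p / p0.
  rewrite /th /be; field.
  by rewrite mulN1r !gt_eqF// subr_gt0.
have qE l : (th l + be l) / th l = P l / p0.
  by rewrite tE /th; field; rewrite !gt_eqF.
have L0 : (0 < #|'I_m|)%N by rewrite card_ord.
have [C C0 CP] := small_exponent_form mu L0 th0 th1 be0.
exists ((C * 2) `^ p^-1); first exact: powR_ge0.
move=> I Q w sigma g Sw V S G a N A mQ LQ mw w0 mg ms g0 s0 wS sS gG S0 V0 a0 Sa NE A0 SA.
have Sw0 i : 0 <= Sw i.
  by rewrite -lee_fin -wS; apply: integral_ge0 => x _; rewrite lee_fin ltW.
have G0 l i : 0 <= G l i.
  by rewrite -lee_fin -gG; apply: integral_ge0 => x _; rewrite lee_fin.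
have N0 l : 0 <= N l.
  by rewrite -lee_fin -NE; apply: integral_ge0 => x _; rewrite lee_fin mulr_ge0 ?powR_ge0.
have GV0 l i : 0 <= G l i / V i by rewrite mulr_ge0// invr_ge0 ltW.
pose c i := \prod_l (G l i / V i) `^ (gam / p0).
have c0 i : 0 <= c i by apply: prodr_ge0 => l _; exact: powR_ge0.
have cE i : c i `^ (p / gam) = \prod_l (G l i / V i) `^ (th l + be l).
  rewrite powR_prod; last by move=> l; exact: powR_ge0.
  apply: eq_bigr => l _; rewrite -powRrM tE; congr (_ `^ _).
  by field; rewrite !gt_eqF.
have pg : 0 < p / gam <= 1 by rewrite divr_gt0//= ler_pdivrMr// mul1r.
(* Since [p / gam <= 1], the power is subadditive and the integral splits over the cubes. *)
have H1 : (\int[mu]_x ((\sum_(i | x \in Q i) c i) `^ (p / gam) * w x)%:E <=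
    \int[mu]_x ((\sum_(i | predT i && (x \in Q i)) c i `^ (p / gam)) * w x)%:E)%E.
  apply: ge0_le_integral => //.
  - by move=> x _; rewrite lee_fin mulr_ge0 ?powR_ge0// ltW.
  - apply/measurable_EFinP/measurable_funM => //.
    apply: (measurableT_comp (measurable_powR _)).
    exact: (@measurable_step _ _ _ _ predT).
  - apply/measurable_EFinP/measurable_funM => //.
    exact: (@measurable_step _ _ _ _ predT).
  - move=> x _; rewrite lee_fin; apply: ler_wpM2r; first exact: ltW.
    exact: powR_sum_le.
apply: (le_trans H1).
rewrite integral_step//; [|by move=> i; exact: powR_ge0|by move=> x; exact: ltW].
under [leLHS]eq_bigr do rewrite wS -EFinM cE.
rewrite sumEFin lee_fin.
have Sa' l j : \sum_(i | sub Q i j) S l i <= (2 * a l) * S l j by exact: Sa.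
have a20 l : 0 <= 2 * a l by rewrite mulr_ge0.
have NE' l : (\int[mu]_x (g l x `^ ((th l + be l) / th l) *
   sigma l x `^ (1 - (th l + be l) / th l))%:E = (N l)%:E)%E by rewrite qE.
apply: (le_trans (CP I Q sigma g S G V Sw (fun l => 2 * a l) N A mQ LQ mg ms g0 s0
  sS gG S0 V0 Sw0 a20 Sa' NE' A0 SA)).
have Pa0 : 0 <= \prod_l a l `^ th l by apply: prodr_ge0 => l _; exact: powR_ge0.
have PN0 : 0 <= \prod_l N l `^ th l by apply: prodr_ge0 => l _; exact: powR_ge0.
have scale (x : 'I_m -> R) : (forall l, 0 <= x l) ->
    (\prod_l x l `^ (P l)^-1) `^ p = \prod_l x l `^ th l.
  move=> x0; rewrite powR_prod; last by move=> l; exact: powR_ge0.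
  by apply: eq_bigr => l _; rewrite -powRrM mulrC.
have pr0 (x : 'I_m -> R) : 0 <= \prod_l x l `^ (P l)^-1.
  by apply: prodr_ge0 => l _; exact: powR_ge0.
rewrite powRM ?mulr_ge0 ?powR_ge0//.
rewrite powRM ?mulr_ge0 ?powR_ge0//.
rewrite powRM ?powR_ge0// !scale// -!powRrM mulVf ?gt_eqF// !powRr1 ?mulr_ge0//.
apply: ler_wpM2r => //.
rewrite -!mulrA; apply: ler_wpM2l => //.
rewrite mulrCA; apply: ler_wpM2l => //.
have := @prod_powR_double _ predT a th a0 (fun l => ltW (th0 l)).
by rewrite th1 powRr1.
Qed.

(** Testing against [u = Phi ^ (s - 1)] writes [X] as a sum over cubes with [m + 1] pairs. The
    energy of the extra pair is [X] again, so [X <= D X ^ (1 - gam / p)], and the power of [X] is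
    divided out. *)
Lemma finite_operator_large (m : nat) (gam p0 p : R) (P : 'I_m -> R) :
  0 < gam -> 0 < p0 -> (forall i, p0 < P i) ->
  p^-1 = \sum_(i < m) (P i)^-1 -> gam < p ->
  exists2 C, 0 <= C & forall (I : finType) (Q : I -> set T) (w : T -> R)
    (sigma g : 'I_m -> T -> R) (Sw V : I -> R) (S G : 'I_m -> I -> R) (aw : R)
    (a N : 'I_m -> R) (A : R),
  (forall i, measurable (Q i)) -> laminar Q ->
  measurable_fun setT w -> (forall x, 0 < w x) ->
  (forall l, measurable_fun setT (g l)) -> (forall l, measurable_fun setT (sigma l)) ->
  (forall l x, 0 <= g l x) -> (forall l x, 0 < sigma l x) ->
  (forall i, \int[mu]_(x in Q i) (w x)%:E = (Sw i)%:E)%E ->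
  (forall l i, \int[mu]_(x in Q i) (sigma l x)%:E = (S l i)%:E)%E ->
  (forall l i, \int[mu]_(x in Q i) (g l x)%:E = (G l i)%:E)%E ->
  (forall i, 0 < Sw i) -> (forall l i, 0 < S l i) -> (forall i, 0 < V i) ->
  (forall j, \sum_(i | sub Q i j) V i <= 2 * V j) ->
  0 <= aw -> (forall l, 0 <= a l) ->
  (forall j, \sum_(i | sub Q i j) Sw i <= 2 * aw * Sw j) ->
  (forall l j, \sum_(i | sub Q i j) S l i <= 2 * a l * S l j) ->
  (forall l, \int[mu]_x (g l x `^ (P l / p0) * sigma l x `^ (1 - P l / p0))%:E = (N l)%:E)%E ->
  0 <= A ->
  (forall i, Sw i / V i * \prod_l (S l i / V i) `^ (p / p0 / (P l / p0 / (P l / p0 - 1))) <= A) ->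
  (\int[mu]_x ((\sum_(i | x \in Q i) \prod_l (G l i / V i) `^ (gam / p0)) `^ (p / gam) * w x)%:E <=
   ((C * A `^ p^-1 * (\prod_l a l `^ (P l)^-1 + aw `^ (gam^-1 - p^-1) *
        \sum_j \prod_(l | l != j) a l `^ (P l)^-1) * \prod_l N l `^ (P l)^-1) `^ p)%:E)%E.
Proof.
move=> gam0 p00 Pp pE gamp.
have p_gt0 : 0 < p by exact: lt_trans gamp.
have P0 l : 0 < P l by exact: lt_trans (Pp l).
(* [None] stands for the pair [(u w, w)], [Some i] for [(g i, sigma i)]. *)
pose th l := if l is Some i then gam / P i else 1 - gam / p.
pose be l := if l is Some i then p / p0 / (P i / p0 / (P i / p0 - 1)) else 1.
pose lam := gam / p.
have gp1 : gam / p < 1 by rewrite ltr_pdivrMr// mul1r.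
have th0 l : 0 < th l by case: l => [i|]; rewrite /th ?subr_gt0// divr_gt0.
have th1 : \sum_l th l = 1.
  rewrite big_optionE/= -big_distrr/= -pE; ring.
have be0 l : 0 < be l.
  by case: l => [i|]; rewrite /be// !divr_gt0// subr_gt0 ltr_pdivlMr// mul1r.
have lam0 : 0 < lam by exact: divr_gt0.
have L0 : (0 < #|{: option 'I_m}|)%N by apply/card_gt0P; exists None.
(* The pair [None] enters linearly, with energy exponent [1 / th None], the conjugate of
   [s = p / gam]; the others enter with power [gam / p0]. *)
have tN : th None + lam * be None = 1 by rewrite /th /be /lam; ring.
have tS i : th (Some i) + lam * be (Some i) = gam / p0.
  rewrite /th /be /lam; field.
  by rewrite mulN1r !gt_eqF// subr_gt0.
have qS i : (th (Some i) + lam * be (Some i)) / th (Some i) = P i / p0.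
  by rewrite tS /th; field; rewrite !gt_eqF.
have [C C0 CP] := large_exponent_form mu L0 th0 th1 be0 lam0.
pose Kc := #|{: option 'I_m}|%:R `^ gam^-1 * 2 `^ gam^-1 : R.
have Kc0 : 0 <= Kc by rewrite mulr_ge0 ?powR_ge0.
exists (C `^ gam^-1 * Kc); first by apply: mulr_ge0 => //; exact: powR_ge0.
move=> I Q w sigma g Sw V S G aw a N A mQ LQ mw w0 mg ms g0 s0 wS sS gG Sw0 S0 V0
  VC aw0 a0 Swa Sa NE A0 SA.
have G0 l i : 0 <= G l i.
  by rewrite -lee_fin -gG; apply: integral_ge0 => x _; rewrite lee_fin.
have N0 l : 0 <= N l.
  by rewrite -lee_fin -NE; apply: integral_ge0 => x _; rewrite lee_fin mulr_ge0 ?powR_ge0.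
have GV0 l i : 0 <= G l i / V i by rewrite mulr_ge0// invr_ge0 ltW.
pose c i := \prod_l (G l i / V i) `^ (gam / p0).
have c0 i : 0 <= c i by apply: prodr_ge0 => l _; exact: powR_ge0.
pose Phi x := \sum_(i | x \in Q i) c i.
have Phi0 x : 0 <= Phi x by exact: sumr_ge0.
have mPhi : measurable_fun setT Phi by exact: (@measurable_step _ _ _ _ predT).
pose s := p / gam.
have s1 : 1 < s by rewrite /s ltr_pdivlMr// mul1r.
have s0' : 0 < s by exact: lt_trans s1.
pose u x := Phi x `^ (s - 1).
have u0 x : 0 <= u x by exact: powR_ge0.
have mu_ : measurable_fun setT u by exact: (measurableT_comp (measurable_powR _)).
pose M := \sum_i c i.
have PhiM x : Phi x <= M.
  by rewrite /Phi /M [leLHS]big_mkcond/=; apply: ler_sum => i _; case: ifP.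
have muw : measurable_fun setT (fun x => u x * w x) by exact: measurable_funM.
have uw0 x : 0 <= u x * w x by rewrite mulr_ge0// ltW.
(* For a finite family [Phi] is bounded by [M], which keeps [u w] integrable on each cube. *)
have uwfin i : (\int[mu]_(x in Q i) (u x * w x)%:E < +oo)%E.
  apply: (@le_lt_trans _ _ (\int[mu]_(x in Q i) ((M `^ (s - 1))%:E * (w x)%:E))%E).
    apply: ge0_le_integral => //.
    - by move=> x _; rewrite lee_fin.
    - by apply/measurable_EFinP; exact: measurable_funTS.
    - by apply: measurable_funeM; apply/measurable_EFinP; exact: measurable_funTS.
    move=> x _; rewrite -EFinM lee_fin; apply: ler_wpM2r; first exact: ltW.
    by rewrite ge0_ler_powR ?nnegrE ?subr_ge0 ?(ltW s1)// sumr_ge0.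
  rewrite ge0_integralZl_EFin//.
  - by rewrite wS -EFinM ltry.
  - by move=> x _; rewrite lee_fin ltW.
  - by apply/measurable_EFinP; exact: measurable_funTS.
  - exact: powR_ge0.
pose H i := fine (\int[mu]_(x in Q i) (u x * w x)%:E).
have HE i : (\int[mu]_(x in Q i) (u x * w x)%:E = (H i)%:E)%E.
  rewrite fineK// ge0_fin_numE ?uwfin//.
  by apply: integral_ge0 => x _; rewrite lee_fin.
pose X := \sum_i c i * H i.
have PhisE x : Phi x `^ s = Phi x * u x.
  have [->|n0] := eqVneq (Phi x) 0; first by rewrite powR0 ?mul0r// gt_eqF.
  rewrite /u -[X in X * _]powRr1// -powRD ?n0 ?implybT//.
  by rewrite addrC subrK.
have XE : (\int[mu]_x (Phi x `^ s * w x)%:E = X%:E)%E.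
  under eq_integral do rewrite PhisE -mulrA.
  rewrite (@integral_step _ _ _ _ _ predT)//.
  by under eq_bigr do rewrite HE -EFinM; rewrite sumEFin.
rewrite -/c -/Phi -/s XE lee_fin.
have X0 : 0 <= X.
  by rewrite -lee_fin -XE; apply: integral_ge0 => x _; rewrite lee_fin mulr_ge0 ?powR_ge0// ltW.
pose sig' l := if l is Some i then sigma i else w.
pose g' l := if l is Some i then g i else fun x => u x * w x.
pose S' l := if l is Some i then S i else Sw.
pose G' l := if l is Some i then G i else H.
pose N' l := if l is Some i then N i else X.
pose a' l := if l is Some i then a i else aw.
have a'0 l : 0 <= a' l by case: l.
have a'20 l : 0 <= 2 * a' l by rewrite mulr_ge0.
have mg' l : measurable_fun setT (g' l) by case: l.
have ms' l : measurable_fun setT (sig' l) by case: l.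
have g'0 l x : 0 <= g' l x by case: l => [l|]; [exact: g0|exact: uw0].
have s'0 l x : 0 < sig' l x by case: l => [l|]; [exact: s0|exact: w0].
have sS' l i : (\int[mu]_(x in Q i) (sig' l x)%:E = (S' l i)%:E)%E
  by case: l => [l|]; [exact: sS|exact: wS].
have gG' l i : (\int[mu]_(x in Q i) (g' l x)%:E = (G' l i)%:E)%E
  by case: l => [l|]; [exact: gG|exact: HE].
have S'0 l i : 0 < S' l i by case: l => [l|]; [exact: S0|exact: Sw0].
have Sa' l j : \sum_(i | sub Q i j) S' l i <= 2 * a' l * S' l j
  by case: l => [l|]; [exact: Sa|exact: Swa].
(* For the extra pair, with [s'] conjugate to [s], one has [u ^ s' w = Phi ^ s w], so its energy is
   [X]. *)
have NE' l : (\int[mu]_x (g' l x `^ ((th l + lam * be l) / th l) *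
   sig' l x `^ (1 - (th l + lam * be l) / th l))%:E = (N' l)%:E)%E.
  case: l => [i|]; first by rewrite qS NE.
  rewrite tN -XE; apply: eq_integral => x _; congr EFin; rewrite /g' /sig' /th mul1r.
  rewrite powRM ?(ltW (w0 x))// -mulrA -powRD ?(gt_eqF (w0 x)) ?implybT//.
  rewrite [_ + (1 - _)]addrC subrK powRr1 ?(ltW (w0 x))//; congr (_ * _).
  rewrite /u -powRrM; congr (_ `^ _); rewrite /s; field.
  by rewrite !gt_eqF// subr_gt0.
have SA' i : \prod_l (S' l i / V i) `^ be l <= A.
  by rewrite big_optionE/= powRr1 ?SA// ltW// divr_gt0.
have := CP I Q sig' g' S' G' V (fun l => 2 * a' l) N' A mQ LQ mg' ms' g'0 s'0 sS' gG' S'0 V0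
  VC a'20 Sa' NE' SA'.
have -> : \sum_i (\prod_l (G' l i / V i) `^ (th l + lam * be l)) * V i = X.
  apply: eq_bigr => i _; rewrite big_optionE/= tN.
  under eq_bigr do rewrite tS.
  rewrite -/(c i) powRr1; first by field; rewrite gt_eqF.
  rewrite mulr_ge0 ?invr_ge0 ?(ltW (V0 i))// -lee_fin -HE.
  by apply: integral_ge0 => x _; rewrite lee_fin.
rewrite [\prod_l N' l `^ _]big_optionE/=.
set Z := \sum_l _; set Y := \prod_(i < m) _.
have Y0 : 0 <= Y by apply: prodr_ge0 => l _; exact: powR_ge0.
have Z0 : 0 <= Z.
  by apply: sumr_ge0 => l _; apply: prodr_ge0 => l' _; exact: powR_ge0.
(* Dividing by a power of [X] requires [X > 0]; the case [X = 0] is immediate. *)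
have [->|Xn0] := eqVneq X 0; first by move=> _; exact: powR_ge0.
have Xp : 0 < X by rewrite lt_def Xn0.
set D := C * A `^ lam * Z * Y => HD.
have {HD} HD : X `^ lam <= D.
  rewrite -(ler_pM2r (powR_gt0 (1 - gam / p) Xp)) -powRD ?Xn0 ?implybT//.
  rewrite /lam addrC subrK powRr1//; apply: (le_trans HD).
  by rewrite /D le_eqVlt; apply/orP; left; apply/eqP; ring.
have D0 : 0 <= D by apply: le_trans HD; exact: powR_ge0.
have XD : X <= (D `^ gam^-1) `^ p.
  have -> : X = (X `^ lam) `^ (gam^-1 * p).
    rewrite -powRrM /lam (_ : _ * _ = 1) ?powRr1//.
    by field; rewrite !gt_eqF.
  rewrite -[leRHS]powRrM; apply: ge0_ler_powR; rewrite ?nnegrE ?powR_ge0//.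
  by rewrite mulr_ge0 ?invr_ge0// ltW.
apply: (le_trans XD).
have pr0 (x : 'I_m -> R) (B : pred 'I_m) : 0 <= \prod_(l | B l) x l `^ (P l)^-1.
  by apply: prodr_ge0 => l _; exact: powR_ge0.
have B0 : 0 <= \prod_l a l `^ (P l)^-1 + aw `^ (gam^-1 - p^-1) *
        \sum_j \prod_(l | l != j) a l `^ (P l)^-1.
  by apply: addr_ge0 => //; apply: mulr_ge0; [exact: powR_ge0|exact: sumr_ge0].
apply: ge0_ler_powR; rewrite ?nnegrE ?powR_ge0 ?(ltW p_gt0)//.
  by do 3! apply: mulr_ge0 => //; rewrite ?powR_ge0// mulr_ge0 ?powR_ge0.
have -> : D `^ gam^-1 = C `^ gam^-1 * A `^ p^-1 * Z `^ gam^-1 * \prod_l N l `^ (P l)^-1.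
  rewrite /D powRM ?mulr_ge0 ?powR_ge0// powRM ?mulr_ge0 ?powR_ge0// powRM ?powR_ge0//.
  rewrite -powRrM; congr (_ * _ `^ _ * _ * _).
    by rewrite /lam; field; rewrite !gt_eqF.
  rewrite powR_prod; last by move=> l; exact: powR_ge0.
  apply: eq_bigr => l _; rewrite -powRrM; congr (_ `^ _).
  by rewrite /th; field; rewrite !gt_eqF.
apply: ler_wpM2r => //.
have -> : C `^ gam^-1 * Kc * A `^ p^-1 = C `^ gam^-1 * A `^ p^-1 * Kc by ring.
rewrite -[leRHS]mulrA; apply: ler_wpM2l; first by rewrite mulr_ge0 ?powR_ge0.
have gV0 : 0 < gam^-1 by rewrite invr_gt0.
have z0 l : 0 <= \prod_(l' | l' != l) (2 * a' l') `^ th l'.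
  by apply: prodr_ge0 => l' _; exact: powR_ge0.
apply: (le_trans (powR_sum_card gV0 z0)).
rewrite /Kc -mulrA; apply: ler_wpM2l; first exact: powR_ge0.
apply: (@le_trans _ _ (\sum_l 2 `^ gam^-1 * \prod_(l' | l' != l) a' l' `^ (th l' / gam))).
  apply: ler_sum => l _.
  have := prod_powR_double (fun l' => l' != l) a'0 (fun l' => ltW (th0 l')).
  rewrite th1 powRr1// => H2.
  apply: (@le_trans _ _ ((2 * \prod_(l' | l' != l) a' l' `^ th l') `^ gam^-1)).
    apply: ge0_ler_powR; rewrite ?nnegrE ?(ltW gV0)// mulr_ge0// prodr_ge0// => l' _.
    exact: powR_ge0.
  rewrite powRM//; last by apply: prodr_ge0 => l' _; exact: powR_ge0.
  rewrite powR_prod; last by move=> l'; exact: powR_ge0.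
  by under eq_bigr do rewrite -powRrM.
rewrite -big_distrr/=; apply: ler_wpM2l; first exact: powR_ge0.
have thE i : th (Some i) / gam = (P i)^-1 by rewrite /th; field; rewrite !gt_eqF.
(* Omitting [None] gives the product without [aw]; omitting [Some j] keeps [aw] with exponent
   [(1 - gam / p) / gam = 1 / gam - 1 / p]. *)
rewrite big_optionE/= big_optionE/= mul1r le_eqVlt; apply/orP; left; apply/eqP.
congr (_ + _).
  by apply: eq_big => [//|i _]; rewrite /= -/(th (Some i)) thE.
rewrite big_distrr/=; apply: eq_bigr => j _; rewrite big_optionE/=.
congr (_ `^ _ * _); first by field; rewrite !gt_eqF.
by apply: eq_big => [//|i _]; rewrite /= -/(th (Some i)) thE.
Qed.

End finite_families.

Local Open Scope ereal_scope.

(** * Cubes and weights in R^n *)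

Section nonmeasurable.
Context d (T : measurableType d) {R : realType} (mu : {measure set T -> \bar R}).

(* Used for the maximal function, whose measurability is not needed. *)
Lemma ge0_le_integral_nonmeasurable (D : set T) (f g : T -> \bar R) :
  (forall x, D x -> 0 <= f x) -> (forall x, D x -> f x <= g x) ->
  \int[mu]_(x in D) f x <= \int[mu]_(x in D) g x.
Proof.
move=> f0 fg.
have g0 x : D x -> 0 <= g x by move=> Dx; exact: le_trans (f0 _ Dx) (fg _ Dx).
rewrite integral_mkcond [leRHS]integral_mkcond !ge0_integralTE.
- apply: le_ereal_sup => _ /= [h hf <-]; exists h => // x.
  apply: (le_trans (hf x)); rewrite !patchE; case: ifPn => // /set_mem; exact: fg.
- by move=> x; rewrite patchE; case: ifPn => // /set_mem; exact: g0.
- by move=> x; rewrite patchE; case: ifPn => // /set_mem; exact: f0.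
Qed.

Context (I : finType) (Q : I -> set T).
Hypothesis mQ : forall i, measurable (Q i).
Hypothesis LQ : laminar Q.

(** Removing the smaller members from [Q i] leaves disjoint sets [E i] of at least half the measure,
    on which [M] dominates [rho i]. It serves both for [M] a maximal function and for [M = 1]. *)
Lemma packing (V rho : I -> R) (j : I) (M : T -> \bar R) :
  (forall i, mu (Q i) = (V i)%:E) ->
  (forall i, mu (\bigcup_(l in [set l | Q l `<` Q i]) Q l) <= (2^-1)%:E * mu (Q i)) ->
  (forall i, (0 <= rho i)%R) ->
  (forall x, Q j x -> 0 <= M x) ->
  (forall i x, sub Q i j -> Q i x -> (rho i)%:E <= M x) ->
  (\sum_(i | sub Q i j) rho i * V i)%:E <= 2%:E * \int[mu]_(x in Q j) M x.
Proof.
move=> QV spQ rho0 M0 rhoM.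
have [QI _ QL] := LQ.
pose U i := \bigcup_(l in [set l | Q l `<` Q i]) Q l.
have mU i : measurable (U i).
  by apply: fin_bigcup_measurable => // l _; exact: mQ.
have UQ i : U i `<=` Q i by move=> x [l /= [lQ _]] /lQ.
pose E i := Q i `\` U i.
have mE i : measurable (E i) by exact: measurableD.
have VE i : (V i)%:E <= 2%:E * mu (E i).
  have QE : mu (Q i) = mu (E i) + mu (U i).
    rewrite -measureU//; first by rewrite /E setUC setDUK.
    by rewrite /E setDE -setIA setICl setI0.
  have Ufin : mu (U i) \is a fin_num.
    by rewrite ge0_fin_numE// (le_lt_trans (spQ i))// QV -EFinM ltry.
  have Efin : mu (E i) \is a fin_num.
    rewrite ge0_fin_numE// (@le_lt_trans _ _ (mu (Q i)))// ?QV ?ltry// -QV.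
    by rewrite le_measure ?inE//; exact: subDsetl.
  move: QE (spQ i); rewrite -/(U i) QV -(fineK Ufin) -(fineK Efin) -!EFinM -EFinD lee_fin.
  by move=> [->]; rewrite lee_fin; lra.
have disjE i l x : E i x -> E l x -> i = l.
  move=> [Qi Ui] [Ql Ul]; apply: contrapT => il.
  have [QQ|QQ|QQ] := QL i l.
  - by have : (Q i `&` Q l) x by []; rewrite QQ.
  - apply: Ul; exists i => //=; split=> // QQ'; apply: il; apply: QI; exact/seteqP.
  - apply: Ui; exists l => //=; split=> // QQ'; apply: il; apply: QI; exact/seteqP.
apply: (@le_trans _ _ (2%:E * \sum_(i | sub Q i j) (rho i)%:E * mu (E i))).
  rewrite -sumEFin ge0_sume_distrr; last by move=> i _; rewrite mule_ge0 ?lee_fin.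
  apply: lee_sum => i _; rewrite EFinM muleCA; apply: lee_wpmul2l; rewrite ?lee_fin//.
apply: lee_wpmul2l; first by rewrite lee_fin.
have -> : \sum_(i | sub Q i j) (rho i)%:E * mu (E i) =
    \int[mu]_x ((\sum_(i | sub Q i j && (x \in E i)) rho i) * 1)%:E.
  rewrite integral_step//; apply: eq_bigr => i _.
  by rewrite integral_cst// mul1e.
rewrite [leRHS]integral_mkcond; apply: ge0_le_integral_nonmeasurable.
  by move=> x _; rewrite lee_fin mulr1 sumr_ge0.
move=> x _; rewrite mulr1 patchE.
have [[i /andP[ij iE]]|none] := pselect (exists i, sub Q i j && (x \in E i)).
  rewrite (bigD1 i) ?ij ?iE//= big1 ?addr0; last first.
    move=> l /andP[/andP[_ lE] /negP[]]; apply/eqP.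
    by apply: (disjE _ _ x); exact/set_mem.
  have Qix : Q i x by move/set_mem : iE => -[].
  have /asboolP Qij := ij.
  rewrite mem_set; last exact: Qij.
  exact: rhoM.
rewrite big_pred0; last by move=> i; apply/negbTE/negP => iP; apply: none; exists i.
by case: ifPn => // /set_mem; exact: M0.
Qed.

End nonmeasurable.

Section cubes.
Context {R : realType} {n : nat}.
Local Notation mu := (@lebesgue_Rn R n).
Implicit Types (Q : set (Rn R n)) (w : Rn R n -> R).

Lemma measurable_Rn_box (A : 'I_n -> set R) : (forall i, measurable (A i)) ->
  measurable ([set x | forall i, A i (tnth x i)] : set (Rn R n)).
Proof. by move=> mA; apply: sub_caratheodory; apply: sub_sigma_algebra; exact: measurable_box. Qed.

Lemma cube_measurable Q : cube Q -> measurable Q.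
Proof.
move=> [l [l0 [a [b [c ->]]]]].
exact: (@measurable_Rn_box (fun i =>
  [set` Interval (BSide (b i) (tnth a i)) (BSide (c i) (tnth a i + l)%R)])).
Qed.

Lemma cube_measure Q : cube Q -> exists2 V : R, (0 < V)%R & mu Q = V%:E.
Proof.
move=> [l [l0 [a [b [c ->]]]]]; exists (\prod_(i < n) l)%R; first exact: prodr_gt0.
rewrite (@lebesgue_Rn_box R n (fun i =>
  [set` Interval (BSide (b i) (tnth a i)) (BSide (c i) (tnth a i + l)%R)]))//.
rewrite -prodEFin; apply: eq_bigr => i _.
rewrite lebesgue_measure_itv/= lte_fin ltrDl l0 -EFinD; congr EFin; ring.
Qed.

Lemma cube_exists : exists Q, cube Q.
Proof.
exists [set x : Rn R n | forall i, tnth x i \in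
  Interval (BSide true (tnth [tuple of nseq n 0%R] i))
           (BSide true (tnth [tuple of nseq n 0%R] i + 1)%R)].
by exists 1%R; split=> //; exists [tuple of nseq n 0%R], (fun=> true), (fun=> true).
Qed.

(** Local integrability concerns compact sets, so the cube is enclosed in the closed box with the
    same sides. *)
Lemma weight_cube_finite w Q : weight w -> cube Q -> \int[mu]_(x in Q) `|w x|%:E < +oo.
Proof.
move=> [[mw wK] _] cQ; have mQ := cube_measurable cQ.
have [l [l0 [a [b [c QE]]]]] := cQ.
pose K : set (Rn R n) := [set x | forall i, (`[tnth a i, (tnth a i + l)%R]%classic : set R) (tnth x i)].
have mK : measurable K.
  exact: (@measurable_Rn_box (fun i => `[tnth a i, (tnth a i + l)%R]%classic)).
have QK : Q `<=` K.
  rewrite QE => x /= Hx i; have := Hx i; rewrite /= !in_itv/=.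
  move=> /andP[H1 H2]; apply/andP; split.
    by move: H1; case: (b i) => //= /ltW.
  by move: H2; case: (c i) => //= /ltW.
have cK : compact_Rn K.
  rewrite /compact_Rn (_ : _ @` K =
    [set v : 'rV[R]_n | forall i, (`[tnth a i, (tnth a i + l)%R]%classic : set R) (v ord0 i)]).
    apply: (@rV_compact _ _ (fun i => (`[tnth a i, (tnth a i + l)%R]%classic : set R))) => i.
    exact: segment_compact.
  apply/seteqP; split => [_ /= [x Kx <-] i|v vK /=]; first by rewrite mxE; exact: Kx.
  exists [tuple v ord0 i | i < n]; first by move=> i; rewrite tnth_mktuple; exact: vK.
  by apply/rowP => i; rewrite mxE tnth_mktuple.
apply: le_lt_trans (wK K cK).
apply: ge0_subset_integral; [exact: mQ|exact: mK| | |exact: QK].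
  exact/measurable_EFinP/measurable_funTS/measurableT_comp.
by move=> x _; rewrite lee_fin.
Qed.

(* Weights are positive only almost everywhere. *)
Definition positive_version w x := if (0 < w x)%R then w x else 1%R.

Lemma positive_version_gt0 w x : (0 < positive_version w x)%R.
Proof. by rewrite /positive_version; case: ifP. Qed.

Lemma measurable_positive_version w : measurable_fun setT w ->
  measurable_fun setT (positive_version w).
Proof.
move=> mw; apply: measurable_fun_ifT; [|exact: mw|exact: measurable_cst].
by apply: measurable_fun_ltr; [exact: measurable_cst|exact: mw].
Qed.

Lemma positive_version_ae w : weight w -> {ae mu, forall x, positive_version w x = w x /\ (0 < w x)%R}.
Proof.
move=> [_ [N [mN N0 wN]]]; exists N; split=> // x /= H; apply: wN => /= wx; apply: H.
by rewrite /positive_version wx.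
Qed.

(** Changing a weight on a null set preserves its integrals, and a positive function with zero
    integral would force [Q] to be null. The absolute value is included because the maximal function
    averages it. *)
Lemma weight_cube w Q : weight w -> cube Q -> exists S : R, [/\ (0 < S)%R,
  \int[mu]_(x in Q) (positive_version w x)%:E = S%:E,
  \int[mu]_(x in Q) (w x)%:E = S%:E &
  \int[mu]_(x in Q) `|w x|%:E = S%:E].
Proof.
move=> ww cQ; have mQ := cube_measurable cQ.
have [V V0 QV] := cube_measure cQ.
have fin := weight_cube_finite ww cQ.
have ae := positive_version_ae ww.
have [[mw _] _] := ww.
have mp := measurable_positive_version mw.
have E1 : \int[mu]_(x in Q) (positive_version w x)%:E = \int[mu]_(x in Q) (w x)%:E.
  apply: ae_eq_integral; first exact: mQ.
  - exact/measurable_EFinP/(measurable_funTS mp).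
  - exact/measurable_EFinP/(measurable_funTS mw).
  - by apply: filterS ae => x [-> _].
have E2 : \int[mu]_(x in Q) `|w x|%:E = \int[mu]_(x in Q) (w x)%:E.
  apply: ae_eq_integral; first exact: mQ.
  - exact/measurable_EFinP/measurable_funTS/measurableT_comp.
  - exact/measurable_EFinP/(measurable_funTS mw).
  - by apply: filterS ae => x [_ w0] _; rewrite gtr0_norm.
set J := \int[mu]_(x in Q) (positive_version w x)%:E.
have J0 : 0 <= J by apply: integral_ge0 => x _; rewrite lee_fin ltW// positive_version_gt0.
have Jfin : J \is a fin_num by rewrite ge0_fin_numE// /J E1 -E2.
exists (fine J); split; rewrite ?fineK//; last by rewrite E2 -E1.
apply: fine_gt0; rewrite -ge0_fin_numE// Jfin andbT lt_def J0 andbT; apply/eqP => J00.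
have : \int[mu]_(x in Q) `|(positive_version w x)%:E| = 0.
  by rewrite -J00; apply: eq_integral => x _; rewrite gee0_abs// lee_fin ltW// positive_version_gt0.
move/(ae_eq_integral_abs mu mQ) => H.
have {H} [N [mN N0 QN]] : ae_eq mu Q (EFin \o positive_version w) (cst 0).
  by apply: H; apply/measurable_EFinP; exact: measurable_funTS.
have : mu Q <= mu N.
  rewrite le_measure ?inE// => x Qx; apply: QN => /= /(_ Qx) [] /eqP.
  by rewrite gt_eqF// positive_version_gt0.
by rewrite N0 QV lee_fin leNgt V0.
Qed.

End cubes.

(** * Monotone passage to the limit *)

Section limits.
Context d (T : measurableType d) {R : realType} (mu : {measure set T -> \bar R}).

Lemma poweR_ereal_sup (u : nat -> \bar R) (r : R) : (0 < r)%R -> (forall k, 0 <= u k) ->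
  ereal_sup (range u) `^ r <= ereal_sup (range (fun k => u k `^ r)).
Proof.
move=> r0 u0; set s := ereal_sup (range (fun k => u k `^ r)).
have us k : u k `^ r <= s by apply: ereal_sup_ubound; exists k.
have s0 : 0 <= s by apply: le_trans (us 0%N); exact: poweR_ge0.
have rV : (r^-1 * r = 1)%R by rewrite mulVf// gt_eqF.
have rV' : (r * r^-1 = 1)%R by rewrite mulfV// gt_eqF.
have -> : s = (s `^ r^-1) `^ r by rewrite -poweRrM rV poweRe1.
have sup0 : 0 <= ereal_sup (range u).
  by apply: (le_trans (u0 0%N)); apply: ereal_sup_ubound; exists 0%N.
apply: gt0_ler_poweR; rewrite ?in_itv/= ?sup0 ?poweR_ge0 ?leey ?(ltW r0)//.
apply: ge_ereal_sup => _ /= [k _ <-].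
have -> : u k = (u k `^ r) `^ r^-1 by rewrite -poweRrM rV' poweRe1.
by apply: gt0_ler_poweR; rewrite ?in_itv/= ?poweR_ge0 ?leey ?invr_ge0 ?(ltW r0)// s0.
Qed.

(** Monotone convergence carries a uniform bound for partial sums over to their limit;
    [poweR_ereal_sup] controls the power of the limit by the limit of the powers. *)
Lemma integral_poweR_lim_le (u : nat -> T -> \bar R) (w : T -> R) (r : R) (B : \bar R) :
  (0 < r)%R -> (forall k, measurable_fun setT (fun x => u k x `^ r)) ->
  (forall k x, 0 <= u k x) ->
  (forall x, nondecreasing_seq (u ^~ x)) ->
  measurable_fun setT w -> (forall x, (0 <= w x)%R) ->
  (forall k, \int[mu]_x (u k x `^ r * (w x)%:E) <= B) ->
  \int[mu]_x (limn (u ^~ x) `^ r * (w x)%:E) <= B.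
Proof.
move=> r0 mur u0 nu mw w0 uB.
have nv x : nondecreasing_seq (fun k => u k x `^ r).
  move=> i j ij; apply: gt0_ler_poweR; rewrite ?in_itv/= ?u0 ?leey ?(ltW r0)//.
  exact: nu.
have nvw x : nondecreasing_seq (fun k => u k x `^ r * (w x)%:E).
  by move=> i j ij; apply: lee_wpmul2r; rewrite ?lee_fin//; exact: nv.
apply: (@le_trans _ _ (\int[mu]_x limn (fun k => u k x `^ r * (w x)%:E))).
  apply: ge0_le_integral_nonmeasurable => x _.
    by rewrite mule_ge0 ?poweR_ge0 ?lee_fin.
  have -> : limn (fun k => u k x `^ r * (w x)%:E) =
      ereal_sup (range (fun k => u k x `^ r)) * (w x)%:E.
    by apply/cvg_lim => //; apply: cvgeZr => //; exact: ereal_nondecreasing_cvgn.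
  rewrite (cvg_lim _ (ereal_nondecreasing_cvgn (nu x)))//.
  by apply: lee_wpmul2r; [rewrite lee_fin|exact: poweR_ereal_sup].
rewrite monotone_convergence//.
- apply: lime_le; last exact: nearW.
  apply: ereal_nondecreasing_is_cvgn => i j ij; apply: ge0_le_integral_nonmeasurable => x _.
    by rewrite mule_ge0 ?poweR_ge0 ?lee_fin.
  exact: nvw.
- by move=> k; apply: emeasurable_funM => //; exact/measurable_EFinP.
- by move=> k x _; rewrite mule_ge0 ?poweR_ge0 ?lee_fin.
Qed.

End limits.

(** * Dyadic families and the weight constants *)

Section cube_families.
Context {R : realType} {n : nat}.
Local Notation mu := (@lebesgue_Rn R n).
Implicit Types (Q : set (Rn R n)) (w : Rn R n -> R) (D S : set (set (Rn R n))).

Lemma maximal_ge (f : Rn R n -> \bar R) Q x : cube Q -> Q x ->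
  average (abse \o f) Q <= maximal f x.
Proof. by move=> cQ Qx; apply: ereal_sup_ubound; exists Q. Qed.

Lemma average_ge0 (f : Rn R n -> \bar R) Q : (forall x, 0 <= f x) -> 0 <= average f Q.
Proof.
by move=> f0; rewrite /average mule_ge0 ?inve_ge0 ?measure_ge0// integral_ge0.
Qed.

Lemma averageE (f : Rn R n -> \bar R) Q (V F : R) : (0 < V)%R -> mu Q = V%:E ->
  \int[mu]_(x in Q) f x = F%:E -> average f Q = (F / V)%:E.
Proof. by move=> V0 QV QF; rewrite /average QV QF inver gt_eqF// -EFinM mulrC. Qed.

Lemma maximal_ge0 (f : Rn R n -> \bar R) Q x : cube Q -> Q x -> 0 <= maximal f x.
Proof.
by move=> cQ Qx; apply: le_trans (maximal_ge _ cQ Qx); apply: average_ge0 => y /=.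
Qed.

Lemma AinftyP w : weight w -> Ainfty_constant w < +oo ->
  exists a : R, [/\ (0 <= a)%R, Ainfty_constant w = a%:E & forall Q, cube Q ->
    \int[mu]_(x in Q) maximal ((EFin \o w) \_ Q) x <= a%:E * \int[mu]_(x in Q) (w x)%:E].
Proof.
move=> ww wfin.
have val Q : cube Q -> exists S : R, [/\ (0 < S)%R, \int[mu]_(x in Q) (w x)%:E = S%:E,
    0 <= \int[mu]_(x in Q) maximal ((EFin \o w) \_ Q) x &
    (S^-1)%:E * \int[mu]_(x in Q) maximal ((EFin \o w) \_ Q) x <= Ainfty_constant w].
  move=> cQ; have [S [S0 _ wS _]] := weight_cube ww cQ; exists S; split=> //.
    by apply: integral_ge0 => x Qx; exact: maximal_ge0 cQ Qx.
  apply: ereal_sup_ubound; exists Q => //.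
  by rewrite wS inver gt_eqF.
(* A supremum over no cube would be [-oo]; one cube makes it nonnegative. *)
have [Q0 cQ0] := @cube_exists R n.
have A0 : 0 <= Ainfty_constant w.
  have [S [S0 _ M0]] := val _ cQ0; apply: le_trans.
  by rewrite mule_ge0// lee_fin invr_ge0 ltW.
have AE : Ainfty_constant w = (fine (Ainfty_constant w))%:E.
  by rewrite fineK// ge0_fin_numE.
exists (fine (Ainfty_constant w)); split=> //; first exact: fine_ge0.
move=> Q cQ; have [S [S0 -> M0]] := val _ cQ; rewrite -AE.
move=> /(lee_wpmul2l (_ : 0 <= S%:E)); rewrite lee_fin ltW// => /(_ isT).
by rewrite muleA -EFinM mulfV ?gt_eqF// mul1e muleC.
Qed.

(** This is [packing] with [rho i] the average of [w] over [Q i] and [M] the maximal function of [w]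
    restricted to [Q j], which dominates that average on each [Q i] inside [Q j]. The factor 2 is
    the sparseness. *)
Lemma Ainfty_carleson w (a : R) (I : finType) (Q : I -> set (Rn R n)) (V S : I -> R) :
  weight w ->
  (forall Q, cube Q ->
    \int[mu]_(x in Q) maximal ((EFin \o w) \_ Q) x <= a%:E * \int[mu]_(x in Q) (w x)%:E) ->
  (forall i, cube (Q i)) -> laminar Q -> (forall i, (0 < V i)%R) ->
  (forall i, mu (Q i) = (V i)%:E) ->
  (forall i, mu (\bigcup_(l in [set l | Q l `<` Q i]) Q l) <= (2^-1)%:E * mu (Q i)) ->
  (forall i, \int[mu]_(x in Q i) (positive_version w x)%:E = (S i)%:E) ->
  forall j, (\sum_(i | sub Q i j) S i <= 2 * a * S j)%R.
Proof.
move=> ww wa cQ LQ V0 QV spQ wS j.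
have mQ i : measurable (Q i) by exact: cube_measurable.
have wS' i : [/\ (0 < S i)%R, \int[mu]_(x in Q i) (w x)%:E = (S i)%:E &
   \int[mu]_(x in Q i) `|w x|%:E = (S i)%:E].
  by have [s [s0 + -> ->]] := weight_cube ww (cQ i); rewrite wS => -[->].
have S0 i : (0 < S i)%R by have [] := wS' i.
have := @packing _ _ _ mu _ _ mQ LQ V (fun i => S i / V i)%R j
  (maximal ((EFin \o w) \_ (Q j))) QV spQ.
rewrite (eq_bigr S); last by move=> i _; rewrite divfK// gt_eqF.
move=> H; rewrite -lee_fin -mulrA EFinM; apply: le_trans (H _ _ _) _.
- by move=> i; rewrite ltW// divr_gt0.
- by move=> x Qx; exact: maximal_ge0 (cQ j) Qx.
- move=> i x /asboolP ij Qx; apply: le_trans (maximal_ge _ (cQ i) Qx).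
  rewrite (averageE (V0 i) (QV i) (F := S i))//.
  have [_ _ <-] := wS' i; apply: eq_integral => y /set_mem Qy /=.
  by rewrite patchE mem_set//; exact: ij.
- apply: lee_wpmul2l; first by rewrite lee_fin.
  by apply: (le_trans (wa _ (cQ j))); have [_ -> _] := wS' j; rewrite EFinM.
Qed.

Lemma AR_constantP m (rs : 'I_m -> R) w (sigma : 'I_m -> Rn R n -> R) :
  AR_constant rs w sigma < +oo -> weight w ->
  exists A : R, [/\ (0 <= A)%R, AR_constant rs w sigma = A%:E &
    forall Q (V Sw : R) (S : 'I_m -> R), cube Q -> (0 < V)%R -> mu Q = V%:E ->
      \int[mu]_(x in Q) (w x)%:E = Sw%:E ->
      (forall l, \int[mu]_(x in Q) (sigma l x)%:E = (S l)%:E) ->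
      (Sw / V * \prod_l (S l / V) `^ ((\sum_(i < m) (rs i)^-1)^-1 / (rs l / (rs l - 1))) <= A)%R].
Proof.
move=> Afin ww; set r := ((\sum_(i < m) (rs i)^-1)^-1)%R.
have A0 : 0 <= AR_constant rs w sigma.
  have [Q0 cQ0] := @cube_exists R n.
  apply: (@le_trans _ _ (average (EFin \o w) Q0 *
     \prod_(i < m) average (EFin \o sigma i) Q0 `^ (r / (rs i / (rs i - 1))))); last first.
    by apply: ereal_sup_ubound; exists Q0.
  apply: mule_ge0; last by apply: prode_ge0 => i _; exact: poweR_ge0.
  have [V V0 QV] := cube_measure cQ0; have [S [S0 _ wS _]] := weight_cube ww cQ0.
  by rewrite (averageE V0 QV wS) lee_fin ltW// divr_gt0.
have AE : AR_constant rs w sigma = (fine (AR_constant rs w sigma))%:E.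
  by rewrite fineK// ge0_fin_numE.
exists (fine (AR_constant rs w sigma)); split=> //; first exact: fine_ge0.
move=> Q V Sw S cQ V0 QV wS sS; rewrite -lee_fin -AE.
apply: ereal_sup_ubound; exists Q => //.
rewrite (averageE V0 QV wS) [in RHS]EFinM -prodEFin; congr (_ * _); apply: eq_bigr => i _.
by rewrite (averageE V0 QV (sS i)) poweR_EFin.
Qed.

(** Cubes of one generation are pairwise disjoint, and each contains a rational point, which labels
    it injectively. *)
Lemma grid_countable D : dyadic_grid D -> countable D.
Proof.
move=> [Dk Dpart _].
apply: (@sub_countable _ _ _ (\bigcup_(k in [set: int])
    [set Q | D Q /\ cube_of_side ((2 : R) ^ k)%R Q])).
  by apply: subset_card_le => Q DQ; have [k kQ] := Dk _ DQ; exists k.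
apply: bigcup_countable => // k _; set Dk' := [set Q | _].
have [_ /trivIsetP tD] := Dpart k.
have /choice[f fP] : forall Q : set (Rn R n), exists q : n.-tuple rat, Dk' Q ->
    Q [tuple ratr (tnth q i) : R | i < n].
  move=> Q; have [[DQ [l0 [a [b [c QE]]]]]|nQ] := pselect (Dk' Q); last by exists [tuple 0%R | i < n].
  (* Coordinates strictly between the endpoints lie in the cube whichever faces belong to it. *)
  have /choice[q qP] : forall i : 'I_n, exists q : rat,
      ratr q \in `](tnth a i), (tnth a i + 2 ^ k)%R[.
    by move=> i; apply: rat_in_itvoo; rewrite ltrDl.
  exists [tuple q i | i < n] => _; rewrite QE /= => i; rewrite !tnth_mktuple.
  have := qP i; rewrite !in_itv/= => /andP[H1 H2].
  by case: (b i); case: (c i); rewrite /= ?(ltW H1) ?(ltW H2) ?H1 ?H2.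
apply/countable_injP; exists (pickle \o f) => Q Q' /set_mem DQ /set_mem DQ' /=.
move=> /(pcan_inj pickleK) ff; apply: contrapT => QQ'.
have := tD Q Q' DQ DQ' (introN eqP QQ'); apply/eqP/set0P.
by exists [tuple ratr (tnth (f Q) i) : R | i < n]; split; [exact: fP|rewrite ff; exact: fP].
Qed.

(** The predicate [B] marks the indices in use, so finite and infinite families are treated alike
    and an [esum] becomes a series. *)
Lemma countable_enumeration S : countable S ->
  exists (e : nat -> set (Rn R n)) (B : pred nat), set_inj B e /\ e @` B = S.
Proof.
move=> /countable_injP[f fI].
pose B k := `[< exists2 Q, S Q & f Q = k >].
have /choice[e eP] : forall k, exists Q, B k -> S Q /\ f Q = k.
  move=> k; have [[Q SQ fQ]|nB] := pselect (exists2 Q, S Q & f Q = k); first by exists Q.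
  by exists set0 => /asboolP/nB.
exists e, B; split.
  by move=> i j /set_mem Bi /set_mem Bj eij; rewrite -(eP i Bi).2 -(eP j Bj).2 eij.
apply/seteqP; split => [_ /= [k Bk <-]|Q SQ]; first by have [] := eP k Bk.
have Bf : B (f Q) by apply/asboolP; exists Q.
exists (f Q) => //; have [SeQ feQ] := eP _ Bf.
by apply: fI => //; exact/mem_set.
Qed.

Lemma grid_laminar D (I : finType) (Q : I -> set (Rn R n)) :
  dyadic_grid D -> injective Q -> (forall i, D (Q i)) -> laminar Q.
Proof.
move=> [Dk _ DD] QI DQ; split => // i; last by move=> j; exact: DD.
have [k kQ] := Dk _ (DQ i).
have [V V0 QV] : exists2 V : R, (0 < V)%R & mu (Q i) = V%:E.
  by apply: cube_measure; exists (2 ^ k)%R.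
apply/set0P/negP => /eqP Q0; move: QV; rewrite Q0 measure0 => -[] V00.
by rewrite -V00 ltxx in V0.
Qed.

Lemma sparse_subfamily D S (I : finType) (Q : I -> set (Rn R n)) i :
  sparse_family D S -> (forall i, S (Q i)) ->
  mu (\bigcup_(l in [set l | Q l `<` Q i]) Q l) <= (2^-1)%:E * mu (Q i).
Proof.
move=> [_ SP] SQ; apply: le_trans (SP _ (SQ i)).
apply: le_mu_ext => x [l /= lQ Qx]; exists (Q l) => //=.
Qed.

End cube_families.

(** * The theorem *)

(** For [p <= gam] the second summand only enlarges the bound of [finite_operator_small]; for
    [gam < p] the maximum is the exponent of [finite_operator_large]. *)
Lemma finite_operator_bound d (T : measurableType d) {R : realType} (mu : {measure set T -> \bar R})
    (m : nat) (gam p0 p : R) (P : 'I_m -> R) :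
  (0 < m)%N -> (0 < gam)%R -> (0 < p0)%R -> (forall i, (p0 < P i)%R) ->
  (p^-1 = \sum_(i < m) (P i)^-1)%R ->
  exists2 C : R, (0 <= C)%R & forall (I : finType) (Q : I -> set T) (w : T -> R)
    (sigma g : 'I_m -> T -> R) (Sw V : I -> R) (S G : 'I_m -> I -> R) (aw : R)
    (a N : 'I_m -> R) (A : R),
  (forall i, measurable (Q i)) -> laminar Q ->
  measurable_fun setT w -> (forall x, (0 < w x)%R) ->
  (forall l, measurable_fun setT (g l)) -> (forall l, measurable_fun setT (sigma l)) ->
  (forall l x, (0 <= g l x)%R) -> (forall l x, (0 < sigma l x)%R) ->
  (forall i, \int[mu]_(x in Q i) (w x)%:E = (Sw i)%:E) ->
  (forall l i, \int[mu]_(x in Q i) (sigma l x)%:E = (S l i)%:E) ->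
  (forall l i, \int[mu]_(x in Q i) (g l x)%:E = (G l i)%:E) ->
  (forall i, (0 < Sw i)%R) -> (forall l i, (0 < S l i)%R) -> (forall i, (0 < V i)%R) ->
  (forall j, (\sum_(i | sub Q i j) V i <= 2 * V j)%R) ->
  (0 <= aw)%R -> (forall l, (0 <= a l)%R) ->
  (forall j, (\sum_(i | sub Q i j) Sw i <= 2 * aw * Sw j)%R) ->
  (forall l j, (\sum_(i | sub Q i j) S l i <= 2 * a l * S l j)%R) ->
  (forall l, \int[mu]_x (g l x `^ (P l / p0) * sigma l x `^ (1 - P l / p0))%:E = (N l)%:E) ->
  (0 <= A)%R ->
  (forall i, (Sw i / V i * \prod_l (S l i / V i) `^ (p / p0 / (P l / p0 / (P l / p0 - 1))) <= A)%R) ->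
  \int[mu]_x ((\sum_(i | x \in Q i) \prod_l (G l i / V i) `^ (gam / p0)) `^ (p / gam) * w x)%:E <=
   ((C * A `^ p^-1 * (\prod_l a l `^ (P l)^-1 + aw `^ (Num.max (gam^-1 - p^-1) 0) *
        \sum_j \prod_(l | l != j) a l `^ (P l)^-1) * \prod_l N l `^ (P l)^-1) `^ p)%:E.
Proof.
move=> m0 gam0 p00 Pp pE.
have P0 l : (0 < P l)%R by exact: lt_trans (Pp l).
have pV0 : (0 < p^-1)%R by rewrite pE sum_gt0 ?card_ord// => l; rewrite invr_gt0.
have p_gt0 : (0 < p)%R by rewrite -invr_gt0.
have [pgam|gamp] := leP p gam.
  have [C C0 CP] := finite_operator_small mu m0 gam0 p00 Pp pE pgam.
  exists C; first exact: C0.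
  move=> I Q w sigma g Sw V S G aw a N A mQ LQ mw w0 mg ms g0 s0 wS sS gG Sw0 S0 V0
    VC aw0 a0 Swa Sa NE A0 SA.
  apply: (le_trans (CP I Q w sigma g Sw V S G a N A mQ LQ mw w0 mg ms g0 s0 wS sS gG S0 V0
    a0 Sa NE A0 SA)).
  have pr0 (x : 'I_m -> R) (B : pred 'I_m) : (0 <= \prod_(l | B l) x l `^ (P l)^-1)%R.
    by apply: prodr_ge0 => l _; exact: powR_ge0.
  have CA0 : (0 <= C * A `^ p^-1)%R by rewrite mulr_ge0 ?powR_ge0.
  have B0 : (0 <= aw `^ (Num.max (gam^-1 - p^-1) 0) *
      \sum_j \prod_(l | l != j) a l `^ (P l)^-1)%R.
    by rewrite mulr_ge0 ?powR_ge0 ?sumr_ge0.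
  rewrite lee_fin; apply: ge0_ler_powR; rewrite ?nnegrE ?(ltW p_gt0)//.
  - by apply: mulr_ge0 => //; exact: mulr_ge0.
  - by apply: mulr_ge0 => //; apply: mulr_ge0 => //; exact: addr_ge0.
  by apply: ler_wpM2r => //; apply: ler_wpM2l => //; rewrite lerDl.
have [C C0 CP] := finite_operator_large mu gam0 p00 Pp pE gamp.
exists C; first exact: C0.
move=> I Q w sigma g Sw V S G aw a N A mQ LQ mw w0 mg ms g0 s0 wS sS gG Sw0 S0 V0
  VC aw0 a0 Swa Sa NE A0 SA.
rewrite (_ : Num.max _ _ = gam^-1 - p^-1)%R; last first.
  by apply/max_idPl; rewrite subr_ge0 lef_pV2 ?posrE// ltW.
exact: (CP I Q w sigma g Sw V S G aw a N A mQ LQ mw w0 mg ms g0 s0 wS sS gG Sw0 S0 V0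
  VC aw0 a0 Swa Sa NE A0 SA).
Qed.

(** * Weighted integrability and change of density *)

Section weighted_integrals.
Context d (T : measurableType d) {R : realType} (mu : {measure set T -> \bar R}).

(** Pointwise [g <= g ^ q sigma ^ (1 - q) + sigma]: when [g > sigma], the first term is
    [g (g / sigma) ^ (q - 1)]. Both terms are integrable on [Q]. *)
Lemma weighted_integrable (q : R) (g sigma : T -> R) (Q : set T) (S : R) :
  (1 < q)%R -> measurable Q -> measurable_fun setT g -> measurable_fun setT sigma ->
  (forall x, (0 <= g x)%R) -> (forall x, (0 < sigma x)%R) ->
  \int[mu]_(x in Q) (sigma x)%:E = S%:E ->
  \int[mu]_x (g x `^ q * sigma x `^ (1 - q))%:E < +oo ->
  \int[mu]_(x in Q) (g x)%:E < +oo.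
Proof.
move=> q1 mQ mg ms g0 s0 QS Nfin.
have mN : measurable_fun setT (fun x => g x `^ q * sigma x `^ (1 - q))%R.
  by apply: measurable_funM; exact: (measurableT_comp (measurable_powR _)).
have N0 x : (0 <= g x `^ q * sigma x `^ (1 - q))%R by rewrite mulr_ge0 ?powR_ge0.
apply: (@le_lt_trans _ _ (\int[mu]_(x in Q)
    ((g x `^ q * sigma x `^ (1 - q))%:E + (sigma x)%:E))).
  apply: ge0_le_integral_nonmeasurable => x _; first by rewrite lee_fin.
  rewrite -EFinD lee_fin.
  have [gs|sg] := leP (g x) (sigma x); first by apply: ler_wpDl.
  apply: ler_wpDr; first exact: ltW.
  have gp : (0 < g x)%R by exact: lt_trans sg.
  have -> : (g x `^ q * sigma x `^ (1 - q) = g x * (g x / sigma x) `^ (q - 1))%R.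
    rewrite powRM ?invr_ge0 ?(ltW (s0 x))// -powR_inv1 ?(ltW (s0 x))// -powRrM mulrA.
    congr (_ * _ `^ _)%R; last by ring.
    rewrite -[X in (X * _)%R]powRr1// -powRD ?(gt_eqF gp) ?implybT//.
    by congr (_ `^ _)%R; ring.
  rewrite ler_peMr//; apply: (@le_trans _ _ (1 `^ (q - 1))%R); first by rewrite powR1.
  apply: ge0_ler_powR; rewrite ?nnegrE ?subr_ge0 ?(ltW q1) ?divr_ge0 ?(ltW (s0 x))//.
  by rewrite ler_pdivlMr// mul1r ltW.
rewrite ge0_integralD//=.
- rewrite QS lte_add_pinfty ?ltry//; apply: le_lt_trans Nfin.
  apply: ge0_subset_integral => //; first exact/measurable_EFinP.
  by move=> x _; rewrite lee_fin.
- by move=> x _; rewrite lee_fin.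
- by apply: measurable_funTS; exact/measurable_EFinP.
- by move=> x _; rewrite lee_fin ltW.
- by apply: measurable_funTS; exact/measurable_EFinP.
Qed.

Lemma measurable_nat_step (e : nat -> set T) (B : pred nat) (c : nat -> R) k :
  (forall i, B i -> measurable (e i)) ->
  measurable_fun setT (fun x => \sum_(0 <= i < k | B i) (c i * \1_(e i) x)%:E).
Proof.
move=> me; under eq_fun do rewrite big_mkcond.
apply: emeasurable_sum => i; case: (boolP (B i)) => [Bi|_]; last exact: measurable_cst.
apply/measurable_EFinP; apply: measurable_funM; first exact: measurable_cst.
by apply: measurable_indic; exact: me.
Qed.

Lemma integral_ae_density (v : T -> \bar R) (w w' : T -> R) :
  measurable_fun setT v -> measurable_fun setT w -> measurable_fun setT w' ->
  {ae mu, forall x, w x = w' x} ->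
  \int[mu]_x (v x * (w x)%:E) = \int[mu]_x (v x * (w' x)%:E).
Proof.
move=> mv mw mw' ww'; apply: ae_eq_integral => //.
- by apply: emeasurable_funM => //; exact/measurable_EFinP.
- by apply: emeasurable_funM => //; exact/measurable_EFinP.
- by apply: filterS ww' => x ->.
Qed.

End weighted_integrals.

Section assembly.
Context {R : realType} {n : nat}.
Local Notation mu := (@lebesgue_Rn R n).

Lemma positive_version_aeE (w : Rn R n -> R) : weight w ->
  {ae mu, forall x, w x = positive_version w x}.
Proof. by move=> ww; apply: filterS (positive_version_ae ww) => x [-> _]. Qed.

(** Moves the norm of a given function to the everywhere positive weight that the finite estimates
    require. *)
Lemma weighted_norm_ae (p r : R) (sigma f : Rn R n -> R) (g : Rn R n -> R) :
  weight sigma -> measurable_fun setT g -> (forall x, `|f x| `^ p = g x)%R ->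
  \int[mu]_x (`|(EFin \o f) x| `^ p * (sigma x `^ r)%:E) =
  \int[mu]_x (g x * positive_version sigma x `^ r)%:E.
Proof.
move=> ws mg fg; have [[ms _] _] := ws.
have mp := measurable_positive_version ms.
transitivity (\int[mu]_x ((g x)%:E * (sigma x `^ r)%:E)).
  by apply: eq_integral => x _; rewrite -fg -poweR_EFin.
transitivity (\int[mu]_x ((g x)%:E * (positive_version sigma x `^ r)%:E)).
  apply: (integral_ae_density (v := EFin \o g)).
  - exact: measurableT_comp.
  - exact: (measurableT_comp (measurable_powR _)).
  - exact: (measurableT_comp (measurable_powR _)).
  - by apply: filterS (positive_version_aeE ws) => x ->.
by apply: eq_integral => x _; rewrite EFinM.
Qed.

Lemma Lp_averageE (p0 : R) (f : Rn R n -> R) Q (V G : R) : (0 < V)%R -> mu Q = V%:E ->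
  \int[mu]_(x in Q) (`|f x| `^ p0)%:E = G%:E ->
  Lp_average p0 f Q = ((G / V) `^ p0^-1)%:E.
Proof. by move=> V0 QV QG; rewrite /Lp_average (averageE V0 QV QG) poweR_EFin. Qed.

End assembly.

Theorem theorem1p1 (R : realType) (n m : nat) (gamma p0 p : R) (P : 'I_m -> R)
  (n_gt0 : (0 < n)%N) (m_gt0 : (0 < m)%N)
  (gamma_gt0 : (0 < gamma)%R) (p0_ge1 : (1 <= p0)%R)
  (P_gt : forall i, (p0 < P i)%R)
  (pE : (p^-1 = \sum_(i < m) (P i)^-1)%R)
  (gamma_p : (p0 <= gamma)%R \/ (gamma < p0)%R /\ (gamma < p)%R) :
  exists C : R,
  forall (D S : set (set (Rn R n))), dyadic_grid D -> sparse_family D S ->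
  forall (w : Rn R n -> R) (sigma : 'I_m -> Rn R n -> R),
  weight w -> (forall i, weight (sigma i)) ->
  AR_constant (fun i => P i / p0)%R w sigma < +oo ->
  Ainfty_constant w < +oo -> (forall i, Ainfty_constant (sigma i) < +oo) ->
  let wi i := (fun x => sigma i x `^ (1 - P i / p0))%R in
  forall f : 'I_m -> Rn R n -> R,
  (forall i, weighted_Lp (P i) (wi i) (f i)) ->
  weighted_norm p w (sparse_operator p0 gamma S f) <=
  C%:E * AR_constant (fun i => P i / p0)%R w sigma `^ p^-1 *
  (\prod_(i < m) Ainfty_constant (sigma i) `^ (P i)^-1 +
   Ainfty_constant w `^ Num.max (gamma^-1 - p^-1)%R 0%R *
   \sum_(j < m) \prod_(i < m | i != j) Ainfty_constant (sigma i) `^ (P i)^-1) *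
  \prod_(i < m) weighted_norm (P i) (wi i) (EFin \o f i).
Proof.
have p00 : (0 < p0)%R by exact: lt_le_trans p0_ge1.
have P0 l : (0 < P l)%R by exact: lt_trans (P_gt l).
have pV0 : (0 < p^-1)%R by rewrite pE sum_gt0 ?card_ord// => l; rewrite invr_gt0.
have p_gt0 : (0 < p)%R by rewrite -invr_gt0.
have q1 l : (1 < P l / p0)%R by rewrite ltr_pdivlMr// mul1r.
have [C C0 CP] := finite_operator_bound (@lebesgue_Rn R n) m_gt0 gamma_gt0 p00 P_gt pE.
exists C => D S gD spS w sigma ww ws ARfin wfin sfin wi f fL.
have [aw [aw0 awE awP]] := AinftyP ww wfin.
have /choice[a aP] := fun l => AinftyP (ws l) (sfin l).
have a0 l : (0 <= a l)%R by have [] := aP l.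
have aE l : Ainfty_constant (sigma l) = (a l)%:E by have [] := aP l.
have [A [A0 AE AP]] := AR_constantP ARfin ww.
(* The exponents [P i / p0] give [r = p / p0] in the [A_R] constant. *)
have rE : ((\sum_(i < m) (P i / p0)^-1)^-1 = p / p0)%R.
  under eq_bigr do rewrite invf_div mulrC.
  by rewrite -big_distrl/= -pE invfM invrK.
have mf l : measurable_fun setT (f l) by have [] := fL l.
pose g l x := (`|f l x| `^ p0)%R.
have mg l : measurable_fun setT (g l).
  by apply: (measurableT_comp (measurable_powR _)); exact: measurableT_comp.
have g0 l x : (0 <= g l x)%R by exact: powR_ge0.
pose w' := positive_version w.
pose s' l := positive_version (sigma l).
have mw' : measurable_fun setT w' by apply: measurable_positive_version; have [[]] := ww.
have ms' l : measurable_fun setT (s' l) by apply: measurable_positive_version; have [[]] := ws l.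
have w'0 x : (0 < w' x)%R by exact: positive_version_gt0.
have s'0 l x : (0 < s' l x)%R by exact: positive_version_gt0.
pose J l := \int[@lebesgue_Rn R n]_x (g l x `^ (P l / p0) * s' l x `^ (1 - P l / p0))%:E.
have J0 l : 0 <= J l.
  by apply: integral_ge0 => x _; rewrite lee_fin mulr_ge0 ?powR_ge0.
(* [|f l| ^ P l = g l ^ (P l / p0)] turns the given norm into the energy of [g l]. *)
have normE l : weighted_norm (P l) (wi l) (EFin \o f l) = J l `^ (P l)^-1.
  have fg x : (`|f l x| `^ P l = g l x `^ (P l / p0))%R.
    by rewrite /g -powRrM mulrC divfK// gt_eqF.
  have H := @weighted_norm_ae _ _ (P l) (1 - P l / p0) (sigma l) (f l) _ (ws l)
    (measurableT_comp (measurable_powR _) (mg l)) fg.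
  exact: (congr1 (fun y => y `^ (P l)^-1) H).
have Jfin l : J l < +oo.
  have [_] := fL l; rewrite normE; apply: lty_poweRy.
  by rewrite gt_eqF// invr_gt0.
pose N l := fine (J l).
have NE l : J l = (N l)%:E by rewrite fineK// ge0_fin_numE.
have Dcube Q : D Q -> cube Q.
  by move=> DQ; have [Dk _ _] := gD; have [k kQ] := Dk _ DQ; exists (2 ^ k)%R.
have SD : S `<=` D by have [] := spS.
have [e [B [eI eB]]] : exists (e : nat -> set (Rn R n)) (B : pred nat), set_inj B e /\ e @` B = S.
  apply: countable_enumeration; apply: sub_countable (grid_countable gD).
  exact: subset_card_le.
have eS k : B k -> S (e k) by move=> Bk; rewrite -eB; exists k.
pose V (Q : set (Rn R n)) := fine (lebesgue_Rn Q).
pose Sw (Q : set (Rn R n)) := fine (\int[@lebesgue_Rn R n]_(x in Q) (w' x)%:E).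
pose Ss l (Q : set (Rn R n)) := fine (\int[@lebesgue_Rn R n]_(x in Q) (s' l x)%:E).
pose G l (Q : set (Rn R n)) := fine (\int[@lebesgue_Rn R n]_(x in Q) (g l x)%:E).
have VP (Q : set (Rn R n)) : cube Q -> (0 < V Q)%R /\ lebesgue_Rn Q = (V Q)%:E.
  by move=> cQ; have [v v0 vE] := cube_measure cQ; rewrite /V vE.
have SwP (Q : set (Rn R n)) : cube Q ->
    [/\ (0 < Sw Q)%R, \int[@lebesgue_Rn R n]_(x in Q) (w' x)%:E = (Sw Q)%:E &
    \int[@lebesgue_Rn R n]_(x in Q) (w x)%:E = (Sw Q)%:E].
  by move=> cQ; have [v [v0 vE vE' _]] := weight_cube ww cQ; rewrite /Sw vE vE'.
have SsP l (Q : set (Rn R n)) : cube Q ->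
    [/\ (0 < Ss l Q)%R, \int[@lebesgue_Rn R n]_(x in Q) (s' l x)%:E = (Ss l Q)%:E &
    \int[@lebesgue_Rn R n]_(x in Q) (sigma l x)%:E = (Ss l Q)%:E].
  by move=> cQ; have [v [v0 vE vE' _]] := weight_cube (ws l) cQ; rewrite /Ss vE vE'.
(* Integrability of [g l] on cubes is a consequence of its finite energy. *)
have GP l (Q : set (Rn R n)) : cube Q -> \int[@lebesgue_Rn R n]_(x in Q) (g l x)%:E = (G l Q)%:E.
  move=> cQ; rewrite fineK// ge0_fin_numE; last by apply: integral_ge0 => x _; rewrite lee_fin.
  have [_ sE _] := SsP l _ cQ.
  exact: (weighted_integrable (q1 l) (cube_measurable cQ) (mg l) (ms' l) (g0 l) (s'0 l) sE (Jfin l)).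
pose c Q := (\prod_l (G l Q / V Q) `^ (gamma / p0))%R.
have c0 Q : (0 <= c Q)%R by apply: prodr_ge0 => l _; exact: powR_ge0.
have cE Q : cube Q -> (\prod_(i < m) Lp_average p0 (f i) Q) `^ gamma = (c Q)%:E.
  move=> cQ; have [v0 vE] := VP _ cQ.
  under eq_bigr do rewrite (Lp_averageE v0 vE (GP _ _ cQ)).
  rewrite prodEFin poweR_EFin powR_prod; last by move=> l; exact: powR_ge0.
  congr EFin; apply: eq_bigr => l _; rewrite -powRrM; congr (_ `^ _)%R.
  exact: mulrC.
(* [t Q] is the summand of a single cube, and [u k] sums those with index below [k] in the
   enumeration. *)
pose t (Q : set (Rn R n)) x : \bar R := (c Q * \1_Q x)%:E.
have t0 Q x : 0 <= t Q x by rewrite lee_fin mulr_ge0.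
pose u k x : \bar R := \sum_(0 <= i < k | B i) t (e i) x.
have u0 k x : 0 <= u k x by apply: sume_ge0.
have nu x : nondecreasing_seq (u ^~ x) by apply: ereal_nondecreasing_series.
have TE x : sparse_operator p0 gamma S f x = limn (u ^~ x) `^ gamma^-1.
  rewrite /sparse_operator -eB esum_pred_image//; last first.
    by move=> i Bi; rewrite mule_ge0 ?poweR_ge0 ?lee_fin.
  congr (_ `^ _); apply: eq_eseriesr => i Bi.
  by rewrite cE ?EFinM//; apply/Dcube/SD/eS.
pose bd := (C * A `^ p^-1 * (\prod_l a l `^ (P l)^-1 + aw `^ (Num.max (gamma^-1 - p^-1) 0) *
        \sum_j \prod_(l | l != j) a l `^ (P l)^-1) * \prod_l N l `^ (P l)^-1)%R.
have bd0 : (0 <= bd)%R.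
  rewrite /bd; apply: mulr_ge0; last by apply: prodr_ge0 => l _; exact: powR_ge0.
  apply: mulr_ge0; first by rewrite mulr_ge0 ?powR_ge0.
  apply: addr_ge0; first by apply: prodr_ge0 => l _; exact: powR_ge0.
  apply: mulr_ge0; first exact: powR_ge0.
  by apply: sumr_ge0 => j _; apply: prodr_ge0 => l _; exact: powR_ge0.
(* All constants and norms are finite, so the right-hand side is the real number [bd]. *)
have -> : C%:E * AR_constant (fun i => P i / p0)%R w sigma `^ p^-1 *
  (\prod_(i < m) Ainfty_constant (sigma i) `^ (P i)^-1 +
   Ainfty_constant w `^ Num.max (gamma^-1 - p^-1)%R 0%R *
   \sum_(j < m) \prod_(i < m | i != j) Ainfty_constant (sigma i) `^ (P i)^-1) *
  \prod_(i < m) weighted_norm (P i) (wi i) (EFin \o f i) = bd%:E.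
  rewrite /bd !EFinM EFinD EFinM -!prodEFin -sumEFin AE awE !poweR_EFin.
  congr (_ * (_ + _ * _) * _).
  - by apply: eq_bigr => l _; rewrite aE poweR_EFin.
  - by apply: eq_bigr => j _; rewrite -prodEFin; apply: eq_bigr => l _; rewrite aE poweR_EFin.
  - by apply: eq_bigr => l _; rewrite normE NE poweR_EFin.
have finite_step k : \int[@lebesgue_Rn R n]_x (u k x `^ (p / gamma) * (w' x)%:E) <= (bd `^ p)%:E.
  (* The cubes of index below [k] form a finite subfamily, and the constant of the finite estimate
     does not depend on [k]. *)
  pose B' := [pred i : 'I_k | B i].
  pose Q (j : 'I_#|B'|) := e (enum_val j).
  have BQ (j : 'I_#|B'|) : B (nat_of_ord (enum_val j)).
    by have := enum_valP j.
  have SQ j : S (Q j) by exact: eS.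
  have cQ j : cube (Q j) by apply/Dcube/SD.
  have QI : injective Q.
    move=> i j Qij; apply: enum_val_inj; apply: val_inj.
    by apply: eI Qij; apply: mem_set; exact: BQ.
  have LQ : laminar Q by apply: (grid_laminar gD) => // j; exact: SD.
  have mQ j : measurable (Q j) by exact: cube_measurable.
  have V0 j : (0 < V (Q j))%R by have [] := VP _ (cQ j).
  have QV j : lebesgue_Rn (Q j) = (V (Q j))%:E by have [] := VP _ (cQ j).
  have spQ j := sparse_subfamily j spS SQ.
  (* Packing for Lebesgue measure is the case [rho = 1], [M = 1]. *)
  have VC j : (\sum_(i | sub Q i j) V (Q i) <= 2 * V (Q j))%R.
    have H : (\sum_(i | sub Q i j) 1 * V (Q i))%:E <=
        2%:E * \int[@lebesgue_Rn R n]_(x in Q j) (cst 1 x).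
      by apply: (packing (rho := fun=> 1%R) (M := cst 1) mQ LQ QV spQ).
    have VE : \int[@lebesgue_Rn R n]_(x in Q j) (cst 1 x) = (V (Q j))%:E.
      by rewrite integral_cst// mul1e; exact: QV.
    move: H; rewrite VE -EFinM lee_fin.
    by rewrite (eq_bigr (fun i => V (Q i))) => [|i _]; last by rewrite mul1r.
  have uE x : u k x = (\sum_(j | x \in Q j) c (Q j))%:E.
    rewrite /u big_mkord (eq_bigl (mem B')); last by move=> i; rewrite inE.
    rewrite (big_enum_val (fun i : 'I_k => t (e i) x)) -sumEFin [RHS]big_mkcond/=.
    apply: eq_bigr => j _; rewrite /t -/(Q j) indicE.
    by case: (x \in Q j); rewrite ?mulr1 ?mulr0.
  rewrite (eq_integral (fun x => ((\sum_(j | x \in Q j) c (Q j)) `^ (p / gamma) * w' x)%:E)); last first.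
    by move=> x _; rewrite uE poweR_EFin EFinM.
  apply: (CP _ Q w' s' g (Sw \o Q) (V \o Q) (fun l => Ss l \o Q) (fun l => G l \o Q)
    aw a N A) => //=.
  - by move=> j; have [] := SwP _ (cQ j).
  - by move=> l j; have [] := SsP l _ (cQ j).
  - by move=> l j; exact: GP.
  - by move=> j; have [] := SwP _ (cQ j).
  - by move=> l j; have [] := SsP l _ (cQ j).
  - apply: (Ainfty_carleson ww awP cQ LQ V0 QV spQ) => i.
    by have [] := SwP _ (cQ i).
  - move=> l; have [_ _ alP] := aP l.
    apply: (Ainfty_carleson (ws l) alP cQ LQ V0 QV spQ) => i.
    by have [] := SsP l _ (cQ i).
  - move=> j; rewrite -rE; apply: AP (cQ j) (V0 j) (QV j) _ _.
      by have [] := SwP _ (cQ j).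
    by move=> l; have [] := SsP l _ (cQ j).
have mu_k k : measurable_fun setT (u k).
  apply: (@measurable_nat_step _ _ _ e B (c \o e)) => i Bi.
  exact/cube_measurable/Dcube/SD/eS.
have pg0 : (0 < p / gamma)%R by exact: divr_gt0.
have lim_bound : \int[@lebesgue_Rn R n]_x (limn (u ^~ x) `^ (p / gamma) * (w' x)%:E) <= (bd `^ p)%:E.
  apply: (integral_poweR_lim_le pg0 _ u0 nu mw' (fun x => ltW (w'0 x)) finite_step) => k.
  exact: (measurableT_comp (measurable_poweR _) (mu_k k)).
have mlim : measurable_fun setT (fun x => limn (u ^~ x) : \bar R).
  apply: emeasurable_fun_cvg mu_k _ => x _.
  exact: ereal_nondecreasing_is_cvgn.
(* The powers [gamma^-1] and [p] compose to [p / gamma], and [w] agrees almost everywhere with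
   [w']. *)
have norm_eq : \int[@lebesgue_Rn R n]_x (`|sparse_operator p0 gamma S f x| `^ p * (w x)%:E) =
    \int[@lebesgue_Rn R n]_x (limn (u ^~ x) `^ (p / gamma) * (w' x)%:E).
  have mlp : measurable_fun setT (fun x => limn (u ^~ x) `^ (p / gamma) : \bar R).
    exact: (measurableT_comp (measurable_poweR _) mlim).
  transitivity (\int[@lebesgue_Rn R n]_x (limn (u ^~ x) `^ (p / gamma) * (w x)%:E)).
    apply: eq_integral => x _; rewrite TE gee0_abs ?poweR_ge0//.
    by rewrite -poweRrM [(_^-1 * _)%R]mulrC.
  apply: integral_ae_density; [exact: mlp|by have [[]] := ww|exact: mw'|].
  exact: positive_version_aeE.
rewrite /weighted_norm norm_eq.
have -> : bd%:E = (bd `^ p)%:E `^ p^-1.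
  by rewrite poweR_EFin -powRrM mulfV ?gt_eqF// powRr1.
apply: gt0_ler_poweR; rewrite ?in_itv/= ?leey ?andbT ?(ltW pV0)//.
- by apply: integral_ge0 => x _; rewrite mule_ge0 ?poweR_ge0// lee_fin ltW.
- by rewrite lee_fin powR_ge0.
Qed.
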